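(* Let $\mathcal{B}\subset\mathcal{A}=\mathcal{U}_q(\widehat{\mathfrak{sl}}(2))$ be the quantum affine (left) coideal subalgebra defined by the root space involution $\Theta(\alpha_0)=-\alpha_0-2\alpha_1$, $\Theta(\alpha_1)=\alpha_1$, i.e. the subalgebra generated by the Cartan generator $k_1^{\pm1}$, the Chevalley generators $\xi_1^\pm$ and the twisted affine generator $$B_0^-=\xi_0^-k_0-d_-\big((\mathrm{ad}_r\,\xi_1^+\xi_1^+)\,\xi_0'^{+}\big)k_0,\qquad \xi_0'^{+}=k_0^{-1}\xi_0^+,$$ or alternatively by $k_1^{\pm1}$, $\xi_1^\pm$ and the twisted affine generator $$B_0^+=\xi_0'^{+}k_0-d_+\big((\mathrm{ad}_r\,\xi_1^-\xi_1^-)\,\xi_0^{-}\big)k_0,\qquad d_+=d_-^{-1}(q+q^{-1})^{-2}.$$ If $q^2d_+=q^{-2}d_-=(q+q^{-1})^{-1}$, then $\mathcal{B}$ is a reflection algebra for a vector boundary. That is, the intertwining equation $$(T_{1/z}\otimes T_s)[\Delta(b)]\,K(z)=K(z)\,(T_z\otimes T_s)[\Delta(b)]\qquad\text{for all }b\in\mathcal{B}$$ defines a $K$-matrix $K(z)\in\mathrm{End}(\mathcal V\otimes\mathcal W)$ satisfying the reflection equation $$R_{12}(z/w)\,K_{13}(z)\,R_{12}(zw)\,K_{23}(w)=K_{23}(w)\,R_{12}(zw)\,K_{13}(z)\,R_{12}(z/w)$$ on $\mathcal{V}\otimes\mathcal{V}\otimes\mathcal{W}$.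
   Context: $q\in\mathbb{C}^\times$ is transcendental. $\mathcal{U}_q(\widehat{\mathfrak{sl}}(2))$ is generated by $\xi_i^\pm,k_i^{\pm1}$ ($i=0,1$) with relations $k_ik_j=k_jk_i$, $k_i\xi_j^\pm=q^{\pm\hat a_{ij}}\xi_j^\pm k_i$, $[\xi_i^+,\xi_j^-]=\delta_{ij}\frac{k_i-k_i^{-1}}{q-q^{-1}}$ and the quantum Serre relations, where $\hat a_{00}=\hat a_{11}=2$, $\hat a_{01}=\hat a_{10}=-2$; its simple roots are $\alpha_0,\alpha_1$. Coproduct: $\Delta(k_i)=k_i\otimes k_i$, $\Delta(\xi_i^+)=\xi_i^+\otimes1+k_i\otimes\xi_i^+$, $\Delta(\xi_i^-)=\xi_i^-\otimes k_i^{-1}+1\otimes\xi_i^-$. A subalgebra $\mathcal B$ is a left coideal subalgebra if $\Delta(b)\in\mathcal A\otimes\mathcal B$ for all $b\in\mathcal B$. Right adjoint action: $(\mathrm{ad}_r\,\xi_i^+)a=k_i^{-1}a\,\xi_i^+-k_i^{-1}\xi_i^+a$, $(\mathrm{ad}_r\,\xi_i^-)a=a\,\xi_i^--\xi_i^-k_i\,a\,k_i^{-1}$, and $(\mathrm{ad}_r\,xy)a=(\mathrm{ad}_r\,x)((\mathrm{ad}_r\,y)a)$. Fundamental evaluation representation on $\mathcal V=\mathbb{C}^2$ with basis $v_1,v_2$ and matrix units $e_{i,j}$: $T_z(\xi_1^+)=e_{1,2}$, $T_z(\xi_1^-)=e_{2,1}$, $T_z(k_1)=q\,e_{1,1}+q^{-1}e_{2,2}$,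 $T_z(\xi_0^+)=z\,e_{2,1}$, $T_z(\xi_0^-)=z^{-1}e_{1,2}$, $T_z(k_0)=q^{-1}e_{1,1}+q\,e_{2,2}$. The boundary space $\mathcal W$ is equivalent to $\mathcal V$, and the boundary representation $T_s$ on it is obtained by replacing $z$ with the boundary spectral parameter $s$. The $R$-matrix on $\mathcal V\otimes\mathcal V$ in the basis $v_1\otimes v_1,v_1\otimes v_2,v_2\otimes v_1,v_2\otimes v_2$ is $$R(z)=\begin{pmatrix}1&0&0&0\\0&r&1-q\,r&0\\0&1-r/q&r&0\\0&0&0&1\end{pmatrix},\qquad r=\frac{z-1}{q\,z-1/q}.$$ Subscripts on $R$ and $K$ indicate the tensor factors acted on.
   Formalization: The reflection equation is stated with R_21 = P R_12 P for the leftmost R_12(z/w) and for the right-hand R_12(zw), as the printed form is false for this R; poles of R and the points z²=1, s=zq^{±2}, where the intertwining equation does not fix K(z), are excluded. *)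

(* Defs.v *)
From HB Require Import structures.
From mathcomp Require Import all_boot all_order all_algebra.
From mathcomp Require Import generic_quotient.
From mathcomp Require Import boolp reals complex mxtens.

Set Implicit Arguments.
Unset Strict Implicit.
Unset Printing Implicit Defensive.

Import GRing.Theory.

Local Open Scope ring_scope.
Local Open Scope quotient_scope.

Reserved Notation "A *t B"
  (at level 40, left associativity, format "A  *t  B").
Notation "A *t B" := (tensmx A B) : ring_scope.

Definition transcendental (R : realType) (x : R[i]) : Prop :=
  ~ algebraicOver (ratr : rat -> R[i]) x.

(* Unital associative F-algebras given by generators X and relations E: terms
   built from X modulo the least congruence that contains E and the axioms of
   unital associative F-algebras. *)

Section Presentation.
Variables (F : fieldType) (X : Type).

Inductive term : Type :=
  | Var of X
  | Zero
  | One
  | Add of term & term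
  | Mul of term & term
  | Scale of F & term.

Inductive cong (E : term -> term -> Prop) : term -> term -> Prop :=
  | cong_rel t u : E t u -> cong E t u
  | cong_refl t : cong E t t
  | cong_sym t u : cong E t u -> cong E u t
  | cong_trans u t v : cong E t u -> cong E u v -> cong E t v
  | cong_Add t t' u u' :
      cong E t t' -> cong E u u' -> cong E (Add t u) (Add t' u')
  | cong_Mul t t' u u' :
      cong E t t' -> cong E u u' -> cong E (Mul t u) (Mul t' u')
  | cong_Scale c t t' : cong E t t' -> cong E (Scale c t) (Scale c t')
  | cong_AddA t u v : cong E (Add t (Add u v)) (Add (Add t u) v)
  | cong_AddC t u : cong E (Add t u) (Add u t)
  | cong_Add0 t : cong E (Add Zero t) t
  | cong_AddN t : cong E (Add (Scale (-1) t) t) Zero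
  | cong_MulA t u v : cong E (Mul t (Mul u v)) (Mul (Mul t u) v)
  | cong_Mul1l t : cong E (Mul One t) t
  | cong_Mul1r t : cong E (Mul t One) t
  | cong_MulDl t u v : cong E (Mul (Add t u) v) (Add (Mul t v) (Mul u v))
  | cong_MulDr t u v : cong E (Mul t (Add u v)) (Add (Mul t u) (Mul t v))
  | cong_ScaleA a b t : cong E (Scale a (Scale b t)) (Scale (a * b) t)
  | cong_Scale1 t : cong E (Scale 1 t) t
  | cong_ScaleDr a t u :
      cong E (Scale a (Add t u)) (Add (Scale a t) (Scale a u))
  | cong_ScaleDl a b t : cong E (Scale (a + b) t) (Add (Scale a t) (Scale b t))
  | cong_ScaleAl a t u : cong E (Scale a (Mul t u)) (Mul (Scale a t) u)
  | cong_ScaleAr a t u : cong E (Scale a (Mul t u)) (Mul t (Scale a u)).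

HB.instance Definition _ := gen_eqMixin term.
HB.instance Definition _ := gen_choiceMixin term.

Variable E : term -> term -> Prop.

Definition congb : rel term := fun t u => `[< cong E t u >].

Lemma congb_equiv : equiv_class_of congb.
Proof.
split=> [t|t u|u t v].
- exact/asboolP/cong_refl.
- by apply/asboolP/asboolP; apply: cong_sym.
- by move=> /asboolP tu /asboolP uv; apply/asboolP; apply: cong_trans tu uv.
Qed.

Canonical congb_equivRel := EquivRelPack congb_equiv.
Canonical congb_encModRel := defaultEncModRel congb.

Definition presented := {eq_quot congb}.

HB.instance Definition _ := EqQuotient.on presented.
HB.instance Definition _ := Choice.on presented.

Lemma presentedP t u :
  \pi_presented%qT t = \pi_presented%qT u <-> cong E t u.
Proof.
split=> [/eqmodP/asboolP//|tu]; exact/eqmodP/asboolP.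
Qed.

Local Notation pi := (\pi_presented%qT).

Lemma cong_repr t : cong E (repr (pi t)) t.
Proof. by apply/presentedP; rewrite reprK. Qed.

Definition pzero : presented := pi Zero.
Definition pone : presented := pi One.
Definition padd (a b : presented) : presented := pi (Add (repr a) (repr b)).
Definition pmul (a b : presented) : presented := pi (Mul (repr a) (repr b)).
Definition pscale c (a : presented) : presented := pi (Scale c (repr a)).
Definition popp (a : presented) : presented := pscale (-1) a.

Lemma pi_Add t u : pi (Add t u) = padd (pi t) (pi u).
Proof. by apply/presentedP; apply: cong_Add; exact/cong_sym/cong_repr. Qed.

Lemma pi_Mul t u : pi (Mul t u) = pmul (pi t) (pi u).
Proof. by apply/presentedP; apply: cong_Mul; exact/cong_sym/cong_repr. Qed.

Lemma pi_Scale c t : pi (Scale c t) = pscale c (pi t).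
Proof. by apply/presentedP; apply: cong_Scale; exact/cong_sym/cong_repr. Qed.

Lemma paddA : associative padd.
Proof.
elim/quotW=> t; elim/quotW=> u; elim/quotW=> v.
rewrite -(pi_Add u v) -(pi_Add t u) -!pi_Add.
exact/presentedP/cong_AddA.
Qed.

Lemma paddC : commutative padd.
Proof.
elim/quotW=> t; elim/quotW=> u; rewrite -!pi_Add; exact/presentedP/cong_AddC.
Qed.

Lemma padd0 : left_id pzero padd.
Proof. elim/quotW=> t; rewrite -pi_Add; exact/presentedP/cong_Add0. Qed.

Lemma paddN : left_inverse pzero popp padd.
Proof.
elim/quotW=> t; rewrite /popp -pi_Scale -pi_Add.
exact/presentedP/cong_AddN.
Qed.

HB.instance Definition _ :=
  GRing.isZmodule.Build presented paddA paddC padd0 paddN.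

Lemma pmulA : associative pmul.
Proof.
elim/quotW=> t; elim/quotW=> u; elim/quotW=> v.
rewrite -(pi_Mul u v) -(pi_Mul t u) -!pi_Mul.
exact/presentedP/cong_MulA.
Qed.

Lemma pmul1l : left_id pone pmul.
Proof. elim/quotW=> t; rewrite -pi_Mul; exact/presentedP/cong_Mul1l. Qed.

Lemma pmul1r : right_id pone pmul.
Proof. elim/quotW=> t; rewrite -pi_Mul; exact/presentedP/cong_Mul1r. Qed.

Lemma pmulDl : left_distributive pmul padd.
Proof.
elim/quotW=> t; elim/quotW=> u; elim/quotW=> v.
rewrite -(pi_Add t u) -!pi_Mul -pi_Add.
exact/presentedP/cong_MulDl.
Qed.

Lemma pmulDr : right_distributive pmul padd.
Proof.
elim/quotW=> t; elim/quotW=> u; elim/quotW=> v.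
rewrite -(pi_Add u v) -!pi_Mul -pi_Add.
exact/presentedP/cong_MulDr.
Qed.

HB.instance Definition _ := GRing.Zmodule_isPzRing.Build presented
  pmulA pmul1l pmul1r pmulDl pmulDr.

Lemma pscaleA a b (x : presented) : pscale a (pscale b x) = pscale (a * b) x.
Proof.
elim/quotW: x => t; rewrite -(pi_Scale b t) -!pi_Scale.
exact/presentedP/cong_ScaleA.
Qed.

Lemma pscale1 : left_id 1 pscale.
Proof. elim/quotW=> t; rewrite -pi_Scale; exact/presentedP/cong_Scale1. Qed.

Lemma pscaleDr : right_distributive pscale +%R.
Proof.
move=> c; elim/quotW=> t; elim/quotW=> u; rewrite -[LHS]/(pscale c (padd _ _)).
rewrite -[RHS]/(padd _ _) -(pi_Add t u) -!pi_Scale -pi_Add.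
exact/presentedP/cong_ScaleDr.
Qed.

Lemma pscaleDl (x : presented) : {morph pscale^~ x : a b / a + b}.
Proof.
elim/quotW: x => t a b; rewrite -[RHS]/(padd _ _) -!pi_Scale -pi_Add.
exact/presentedP/cong_ScaleDl.
Qed.

HB.instance Definition _ := GRing.Zmodule_isLmodule.Build F presented
  pscaleA pscale1 pscaleDr pscaleDl.

Lemma presented_scaleAl (a : F) (x y : presented) : a *: (x * y) = (a *: x) * y.
Proof.
elim/quotW: x => t; elim/quotW: y => u.
rewrite -[LHS]/(pscale a (pmul _ _)) -[RHS]/(pmul (pscale a _) _).
rewrite -(pi_Mul t u) -!pi_Scale -pi_Mul.
exact/presentedP/cong_ScaleAl.
Qed.

Lemma presented_scaleAr (a : F) (x y : presented) : a *: (x * y) = x * (a *: y).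
Proof.
elim/quotW: x => t; elim/quotW: y => u.
rewrite -[LHS]/(pscale a (pmul _ _)) -[RHS]/(pmul _ (pscale a _)).
rewrite -(pi_Mul t u) -!pi_Scale -pi_Mul.
exact/presentedP/cong_ScaleAr.
Qed.

Definition gen (x : X) : presented := pi (Var x).

Variable A : algType F.

Fixpoint eval (f : X -> A) (t : term) : A :=
  match t with
  | Var x => f x
  | Zero => 0
  | One => 1
  | Add t u => eval f t + eval f u
  | Mul t u => eval f t * eval f u
  | Scale c t => c *: eval f t
  end.

(* The algebra morphism extending f; it is one as soon as f satisfies the
   relations (extendE and the morphism lemmas below). *)
Definition extend (f : X -> A) (a : presented) : A := eval f (repr a).

Definition satisfies (f : X -> A) : Prop :=
  forall t u, E t u -> eval f t = eval f u.

Lemma eval_cong f t u : satisfies f -> cong E t u -> eval f t = eval f u.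
Proof.
move=> fE; elim=> {t u} /=; do ?[by move=> *; congruence].
- exact: fE.
- by move=> *; rewrite addrA.
- by move=> *; rewrite addrC.
- by move=> *; rewrite add0r.
- by move=> *; rewrite scaleN1r addNr.
- by move=> *; rewrite mulrA.
- by move=> *; rewrite mul1r.
- by move=> *; rewrite mulr1.
- by move=> *; rewrite mulrDl.
- by move=> *; rewrite mulrDr.
- by move=> *; rewrite scalerA.
- by move=> *; rewrite scale1r.
- by move=> *; rewrite scalerDr.
- by move=> *; rewrite scalerDl.
- by move=> *; rewrite scalerAl.
- by move=> *; rewrite scalerAr.
Qed.

Section Extend.
Variable f : X -> A.
Hypothesis fE : satisfies f.

Lemma extend_pi t : extend f (pi t) = eval f t.
Proof. exact/eval_cong/cong_repr. Qed.

Lemma extendE x : extend f (gen x) = f x.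
Proof. by rewrite extend_pi. Qed.

Lemma extend1 : extend f 1 = 1.
Proof. by rewrite -[1]/(pi One) extend_pi. Qed.

Lemma extendD a b : extend f (a + b) = extend f a + extend f b.
Proof. by rewrite -[a + b]/(pi (Add _ _)) extend_pi. Qed.

Lemma extendM a b : extend f (a * b) = extend f a * extend f b.
Proof. by rewrite -[a * b]/(pi (Mul _ _)) extend_pi. Qed.

Lemma extendZ c a : extend f (c *: a) = c *: extend f a.
Proof. by rewrite -[c *: a]/(pi (Scale _ _)) extend_pi. Qed.

End Extend.

Lemma satisfied_presented_neq0 f :
  satisfies f -> (1 : presented) != 0.
Proof.
move=> fE; apply/eqP => /(congr1 (extend f)).
rewrite extend1// -[0]/(pi Zero) extend_pi// => /eqP.
by rewrite oner_eq0.
Qed.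

End Presentation.

Arguments Zero {F X}.
Arguments One {F X}.

Declare Scope presentation_scope.
Delimit Scope presentation_scope with P.
Bind Scope presentation_scope with term.
Notation "0" := Zero : presentation_scope.
Notation "1" := One : presentation_scope.
Notation "t + u" := (Add t u) : presentation_scope.
Notation "t * u" := (Mul t u) : presentation_scope.
Notation "c *: t" := (Scale c%R t) : presentation_scope.
Notation "- t" := (Scale (-1) t) : presentation_scope.
Notation "t - u" := (Add t (Scale (-1) u)) : presentation_scope.

Inductive subalgebra (F : fieldType) (A : algType F) (S : A -> Prop) :
    A -> Prop :=
  | subalgebra_gen a : S a -> subalgebra S a
  | subalgebra_one : subalgebra S 1
  | subalgebra_add a b :
      subalgebra S a -> subalgebra S b -> subalgebra S (a + b)
  | subalgebra_mul a b :
      subalgebra S a -> subalgebra S b -> subalgebra S (a * b)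
  | subalgebra_scale c a : subalgebra S a -> subalgebra S (c *: a).

Section TensorProduct.
Variables (F : fieldType) (A B : algType F).

Local Notation inA a := (Var F (inl a : A + B)).
Local Notation inB b := (Var F (inr b : A + B)).

(* The tensor product of algebras is generated by a copy a (x) 1 of A and a
   copy 1 (x) b of B that commute with each other. *)
Inductive tensor_relation :
    term F (A + B) -> term F (A + B) -> Prop :=
  | tensor_l1 : tensor_relation (inA 1) 1%P
  | tensor_lD a a' : tensor_relation (inA (a + a')) (inA a + inA a')%P
  | tensor_lM a a' : tensor_relation (inA (a * a')) (inA a * inA a')%P
  | tensor_lZ c a : tensor_relation (inA (c *: a)) (c *: inA a)%P
  | tensor_r1 : tensor_relation (inB 1) 1%P
  | tensor_rD b b' : tensor_relation (inB (b + b')) (inB b + inB b')%P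
  | tensor_rM b b' : tensor_relation (inB (b * b')) (inB b * inB b')%P
  | tensor_rZ c b : tensor_relation (inB (c *: b)) (c *: inB b)%P
  | tensor_comm a b : tensor_relation (inA a * inB b)%P (inB b * inA a)%P.

Definition tensor := presented tensor_relation.

HB.instance Definition _ := GRing.PzRing.on tensor.
HB.instance Definition _ := GRing.Lmodule.on tensor.

Definition tens (a : A) (b : B) : tensor :=
  gen tensor_relation (inl a) * gen tensor_relation (inr b).

(* The linear map a (x) b |-> f a * g b; it is an algebra morphism when f and
   g are algebra morphisms with commuting images. *)
Definition tensor_map (C : algType F) (f : A -> C) (g : B -> C) : tensor -> C :=
  extend (fun x => match x with inl a => f a | inr b => g b end).

End TensorProduct.

Section Uq.
Variables (F : fieldType) (q : F).

Inductive Uq_generator : Type :=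
  | Gxip of 'I_2 | Gxim of 'I_2 | Gk of 'I_2 | GkV of 'I_2.

Local Notation "''xi+_' i" := (Var F (Gxip i)) (at level 8, i at level 2).
Local Notation "''xi-_' i" := (Var F (Gxim i)) (at level 8, i at level 2).
Local Notation "''k_' i" := (Var F (Gk i)) (at level 8, i at level 2).
Local Notation "''k^-1_' i" := (Var F (GkV i)) (at level 8, i at level 2).

Definition cartan (i j : 'I_2) : int := if i == j then 2 else -2.

(* Serre relations have order 1 - cartan i j = 3 for i != j, so the only
   q-binomial coefficient in them besides 1 is [3]_q. *)
Definition qthree : F := q ^+ 2 + 1 + q ^- 2.

Definition serre (x y : term F Uq_generator) : term F Uq_generator :=
  (x * x * x * y - qthree *: (x * x * y * x)
   + qthree *: (x * y * x * x) - y * x * x * x)%P.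

Inductive Uq_relation : term F Uq_generator -> term F Uq_generator -> Prop :=
  | Uq_kkV i : Uq_relation ('k_i * 'k^-1_i)%P 1%P
  | Uq_kVk i : Uq_relation ('k^-1_i * 'k_i)%P 1%P
  | Uq_kk i j : Uq_relation ('k_i * 'k_j)%P ('k_j * 'k_i)%P
  | Uq_kxip i j :
      Uq_relation ('k_i * 'xi+_j)%P (q ^ cartan i j *: ('xi+_j * 'k_i))%P
  | Uq_kxim i j :
      Uq_relation ('k_i * 'xi-_j)%P (q ^ (- cartan i j) *: ('xi-_j * 'k_i))%P
  | Uq_xipxim i j :
      Uq_relation ('xi+_i * 'xi-_j - 'xi-_j * 'xi+_i)%P
                  (((i == j)%:R / (q - q^-1)) *: ('k_i - 'k^-1_i))%P
  | Uq_serre_p i j : i != j -> Uq_relation (serre 'xi+_i 'xi+_j) 0%P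
  | Uq_serre_m i j : i != j -> Uq_relation (serre 'xi-_i 'xi-_j) 0%P.

Definition Uq := presented Uq_relation.

HB.instance Definition _ := GRing.PzRing.on Uq.
HB.instance Definition _ := GRing.Lmodule.on Uq.

(* The counit, used here only to see that Uq is not the zero ring. *)
Definition counit_gen (x : Uq_generator) : F^o :=
  match x with Gxip _ | Gxim _ => 0 | _ => 1 end.

Lemma counit_gen_satisfies : satisfies Uq_relation counit_gen.
Proof.
move=> t u [] //=.
- by move=> i; rewrite mulr1.
- by move=> i; rewrite mulr1.
- by move=> i j; rewrite mulr0 mul0r scaler0.
- by move=> i j; rewrite mulr0 mul0r scaler0.
- by move=> i j; rewrite mulr0 !scaleN1r !subrr scaler0.
- by move=> i j _; rewrite !(mulr0, mul0r, scaler0, addr0).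
- by move=> i j _; rewrite !(mulr0, mul0r, scaler0, addr0).
Qed.

Lemma Uq_oner_neq0 : (1 : Uq) != 0.
Proof. exact: satisfied_presented_neq0 counit_gen_satisfies. Qed.

HB.instance Definition _ := GRing.PzSemiRing_isNonZero.Build Uq Uq_oner_neq0.
HB.instance Definition _ := GRing.LSemiModule_isLSemiAlgebra.Build F Uq
  (@presented_scaleAl _ _ _).
HB.instance Definition _ := GRing.LSemiAlgebra_isSemiAlgebra.Build F Uq
  (@presented_scaleAr _ _ _).

Definition UqUq := tensor Uq Uq.

HB.instance Definition _ := GRing.PzRing.on UqUq.
HB.instance Definition _ := GRing.Lmodule.on UqUq.

Lemma UqUq_oner_neq0 : (1 : UqUq) != 0.
Proof.
have ce := counit_gen_satisfies.
pose f (x : Uq + Uq) : F^o :=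
  match x with inl a | inr a => extend counit_gen a end.
apply: (@satisfied_presented_neq0 _ _ _ F^o f) => t u [] /=; rewrite ?extend1//.
- by move=> *; rewrite extendD.
- by move=> *; rewrite extendM.
- by move=> *; rewrite extendZ.
- by move=> *; rewrite extendD.
- by move=> *; rewrite extendM.
- by move=> *; rewrite extendZ.
- by move=> *; rewrite mulrC.
Qed.

HB.instance Definition _ :=
  GRing.PzSemiRing_isNonZero.Build UqUq UqUq_oner_neq0.
HB.instance Definition _ := GRing.LSemiModule_isLSemiAlgebra.Build F UqUq
  (@presented_scaleAl _ _ _).
HB.instance Definition _ := GRing.LSemiAlgebra_isSemiAlgebra.Build F UqUq
  (@presented_scaleAr _ _ _).

Definition xip (i : 'I_2) : Uq := gen Uq_relation (Gxip i).
Definition xim (i : 'I_2) : Uq := gen Uq_relation (Gxim i).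
Definition ki (i : 'I_2) : Uq := gen Uq_relation (Gk i).
Definition kiV (i : 'I_2) : Uq := gen Uq_relation (GkV i).

Definition coproduct_gen (x : Uq_generator) : UqUq :=
  match x with
  | Gxip i => tens (xip i) 1 + tens (ki i) (xip i)
  | Gxim i => tens (xim i) (kiV i) + tens 1 (xim i)
  | Gk i => tens (ki i) (ki i)
  | GkV i => tens (kiV i) (kiV i)
  end.

Definition coproduct : Uq -> UqUq := extend coproduct_gen.

Definition left_coideal (B : Uq -> Prop) : Prop :=
  forall b, B b -> exists n (a c : 'I_n -> Uq),
    (forall i, B (c i)) /\ coproduct b = \sum_i (tens (a i) (c i) : UqUq).

Definition ad_xip (i : 'I_2) (a : Uq) : Uq :=
  kiV i * a * xip i - kiV i * xip i * a.
Definition ad_xim (i : 'I_2) (a : Uq) : Uq :=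
  a * xim i - xim i * ki i * a * kiV i.

Definition xi0p' : Uq := kiV 0 * xip 0.

Definition Bminus (dm : F) : Uq :=
  xim 0 * ki 0 - dm *: (ad_xip 1 (ad_xip 1 xi0p') * ki 0).
Definition Bplus (dp : F) : Uq :=
  xi0p' * ki 0 - dp *: (ad_xim 1 (ad_xim 1 (xim 0)) * ki 0).

Definition generated_by (b : Uq) : Uq -> Prop :=
  subalgebra (fun a =>
    [\/ a = ki 1, a = kiV 1, a = xip 1 | a = xim 1 \/ a = b]).

(* V = W = F^2, acting on column vectors; v_1, v_2 have indices 0, 1. *)
Local Notation "''e_(' i , j )" := (delta_mx i j : 'M[F]_2).

Definition evaluation_gen (z : F) (x : Uq_generator) : 'M[F]_2 :=
  match x with
  | Gxip i => if i == 1 then 'e_(0, 1) else z *: 'e_(1, 0)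
  | Gxim i => if i == 1 then 'e_(1, 0) else z^-1 *: 'e_(0, 1)
  | Gk i => if i == 1 then q *: 'e_(0, 0) + q^-1 *: 'e_(1, 1)
           else q^-1 *: 'e_(0, 0) + q *: 'e_(1, 1)
  | GkV i => if i == 1 then q^-1 *: 'e_(0, 0) + q *: 'e_(1, 1)
            else q *: 'e_(0, 0) + q^-1 *: 'e_(1, 1)
  end.

Definition evaluation (z : F) : Uq -> 'M[F]_2 := extend (evaluation_gen z).

Definition evaluation2 (z s : F) : UqUq -> 'M[F]_(2 * 2) :=
  tensor_map (C := 'M[F]_4)
    (fun a => evaluation z a *t (1%:M : 'M[F]_2) : 'M[F]_(2 * 2))
    (fun b => (1%:M : 'M[F]_2) *t evaluation s b : 'M[F]_(2 * 2)).

Definition intertwines (B : Uq -> Prop) (s z : F) (M : 'M[F]_(2 * 2)) : Prop :=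
  forall b, B b ->
    evaluation2 z^-1 s (coproduct b) *m M = M *m evaluation2 z s (coproduct b).

(* The intertwining equation determines K(z) = M up to a scalar. *)
Definition is_Kmatrix (B : Uq -> Prop) (s z : F) (M : 'M[F]_(2 * 2)) : Prop :=
  M != 0 /\ forall N, intertwines B s z N <-> exists c, N = c *: M.

(* When z = +-1 and s = z q^(+-2), the two nonzero projections commuting with
   the action of U_q(sl_2) generated by ki 1, xip 1, xim 1 both satisfy the
   intertwining equation, which then does not determine a K-matrix. For all
   other nonzero z and s its space of solutions is a line. *)
Definition generic (s z : F) : Prop :=
  ~ (z ^+ 2 = 1 /\ (s = z * q ^+ 2 \/ s = z * q ^- 2)).

Definition Rmatrix (z : F) : 'M[F]_(2 * 2) :=
  let r := (z - 1) / (q * z - q^-1) in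
  \matrix_(i, j) (nth 0 (nth [::]
    [:: [:: 1; 0;          0;         0];
        [:: 0; r;          1 - q * r; 0];
        [:: 0; 1 - r / q;  r;         0];
        [:: 0; 0;          0;         1]] i) j).

(* The permutation operator v_i (x) v_j |-> v_j (x) v_i. *)
Definition flip : 'M[F]_(2 * 2) :=
  \sum_(i < 2) \sum_(j < 2) 'e_(i, j) *t 'e_(j, i).

(* Operators on V (x) V (x) W acting on the two indicated factors; the index
   types 'I_(2 * 2 * 2) and 'I_(2 * (2 * 2)) are convertible and tensmx uses
   the same lexicographic indexing for both. R is not invariant under
   conjugation by flip, so leg12 and leg21 differ on it. *)
Definition leg12 (X : 'M[F]_(2 * 2)) : 'M[F]_(2 * 2 * 2) :=
  X *t (1%:M : 'M[F]_2).
Definition leg23 (X : 'M[F]_(2 * 2)) : 'M[F]_(2 * 2 * 2) :=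
  (1%:M : 'M[F]_2) *t X.
Definition leg21 (X : 'M[F]_(2 * 2)) := leg12 (flip *m X *m flip).
Definition leg13 (X : 'M[F]_(2 * 2)) := leg23 flip *m leg12 X *m leg23 flip.

End Uq.

(* Main.v *)
(* The coproduct respects the relations because, with x' x = q^2 x x' for the two
   summands x, x' of the coproduct of a generator, the Serre polynomial is additive.

   As operators, [ad xi1+, ad xi1-] acts on weight vectors by a q-integer. So xi0'+
   and xi0- generate three-dimensional adjoint modules, with ad(xi1-)^2 ad(xi1+)^2 =
   (q + q^-1)^2 on xi0'+ and dually on xi0-. Applying ad(xi1-)^2 to B0^- (after
   multiplication by k1, so that the central element k0 k1 factors out) gives a
   multiple of B0^+, and conversely; this is where d+ d- = (q + q^-1)^-2 comes from.

   A matrix that commutes with k1, xi1+ and xi1- on V (x) W is a + b U, where U is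
   the Temperley-Lieb generator, and B0^- imposes one linear equation on (a, b). Since
   P R = 1 + r U, the reflection equation becomes an identity in the algebra generated
   by U_12 and U_23 with U_12 U_23 U_12 = U_12 and U_23 U_12 U_23 = U_23, and it reduces
   to one scalar identity. *)
Require Import Defs.
From mathcomp Require Import all_boot all_order all_algebra.
From mathcomp Require Import boolp reals complex mxtens.
From mathcomp Require Import ring.

Set Implicit Arguments.
Unset Strict Implicit.
Unset Printing Implicit Defensive.

Import GRing.Theory.
Local Open Scope ring_scope.

(** * Linear combinations *)

Section LinearCombinations.
Variables (F : fieldType) (V : lmodType F).

(** Reification splits an identity between linear combinations into one scalar identity per atom.
    Products of the noncommutative algebra count as atoms, so [ring] and [field] only see
    scalars. *)
Inductive lexpr :=
  | LAtom of nat | LZero | LAdd of lexpr & lexpr | LOpp of lexpr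
  | LScale of F & lexpr.

Fixpoint leval (env : seq V) (e : lexpr) : V :=
  match e with
  | LAtom n => nth 0 env n
  | LZero => 0
  | LAdd a b => leval env a + leval env b
  | LOpp a => - leval env a
  | LScale c a => c *: leval env a
  end.

Fixpoint lcoef (e : lexpr) (n : nat) : F :=
  match e with
  | LAtom m => if eqn m n then 1 else 0
  | LZero => 0
  | LAdd a b => lcoef a n + lcoef b n
  | LOpp a => - lcoef a n
  | LScale c a => c * lcoef a n
  end.

Lemma levalE env e :
  leval env e = \sum_(i < size env) lcoef e i *: nth 0 env i.
Proof.
elim: e => [n||a IHa b IHb|a IHa|c a IHa] /=; rewrite ?IHa ?IHb.
(* An index outside the environment evaluates to the default value 0 of [nth], and on the right no
   summand has that index. *)
- have [ltn|gen] := ltnP n (size env); last first.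
    rewrite nth_default// big1// => i _; rewrite -[eqn n i]/(n == i).
    by have [ni|_] := eqVneq; [rewrite leqNgt ni ltn_ord in gen|rewrite scale0r].
  rewrite (bigD1 (Ordinal ltn))//= -[eqn n n]/(n == n) eqxx scale1r big1 ?addr0//.
  move=> i; rewrite -[eqn n i]/(n == i) eq_sym -val_eqE/= => /negbTE->.
  by rewrite scale0r.
- by rewrite big1// => i _; rewrite scale0r.
- by rewrite -big_split /=; apply: eq_bigr => i _; rewrite scalerDl.
- by rewrite -sumrN; apply: eq_bigr => i _; rewrite scaleNr.
- by rewrite scaler_sumr; apply: eq_bigr => i _; rewrite scalerA.
Qed.

(** A recursive conjunction rather than a bounded quantifier, so that [cbn] unfolds it into separate
    goals. *)
Fixpoint agree (n : nat) (a b : lexpr) : Prop :=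
  if n is m.+1 then lcoef a m = lcoef b m /\ agree m a b else True.

Lemma leval_eq env a b : agree (size env) a b -> leval env a = leval env b.
Proof.
move=> ab; rewrite !levalE; apply: eq_bigr => i _; congr (_ *: _).
elim: (size env) ab i => [_ []//|n IH /= [abn /IH{}IH] i].
have [lti|] := ltnP i n; first exact: IH (Ordinal lti).
by rewrite leq_eqVlt ltnNge -ltnS ltn_ord orbF => /eqP<-.
Qed.

End LinearCombinations.


(* Atoms are compared up to conversion because the same product can occur with
   different inheritance paths to its multiplication. *)
Ltac lin_find x l :=
  match l with
  | cons ?y _ => let _ := constr:(erefl : x = y) in constr:(0%N)
  | cons _ ?t => let n := lin_find x t in constr:(S n)
  end.

Ltac lin_atoms t l :=
  lazymatch t with
  | (?a + ?b)%R => let l := lin_atoms a l in lin_atoms b l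
  | (- ?a)%R => lin_atoms a l
  | (_ *: ?a)%R => lin_atoms a l
  | 0%R => l
  | _ => match constr:(Set) with
         | _ => let n := lin_find t l in l
         | _ => constr:(cons t l)
         end
  end.

Ltac lin_reify F t l :=
  lazymatch t with
  | (?a + ?b)%R => let a := lin_reify F a l in let b := lin_reify F b l in
                   constr:(@LAdd F a b)
  | (- ?a)%R => let a := lin_reify F a l in constr:(@LOpp F a)
  | (?c *: ?a)%R => let a := lin_reify F a l in constr:(@LScale F c a)
  | 0%R => constr:(@LZero F)
  | _ => let n := lin_find t l in constr:(@LAtom F n)
  end.

Ltac lin F :=
  lazymatch goal with
  | |- @eq ?T ?a ?b =>
    let l := lin_atoms a (@nil T) in let l := lin_atoms b l in
    let ea := lin_reify F a l in let eb := lin_reify F b l in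
    change (@leval F _ l ea = @leval F _ l eb); apply: leval_eq;
    cbn [agree size lcoef eqn]; repeat split
  end.


(** * The q-Serre polynomial *)

Section QuantumParameter.
Variables (F : fieldType) (q : F).
Hypothesis q_neq0 : q != 0.

(** [field] clears the denominator [q], so this is the shape in which its side conditions appear. *)
Lemma sqr_sub1_neq0 : q - q^-1 != 0 -> q * q - 1 != 0.
Proof.
apply: contraNneq => qq.
by rewrite -(mulfK q_neq0 (_ - _)) mulrBl mulVf// qq mul0r.
Qed.

Lemma sqr_add1_neq0 : q + q^-1 != 0 -> q * q + 1 != 0.
Proof.
apply: contraNneq => qq.
by rewrite -(mulfK q_neq0 (_ + _)) mulrDl mulVf// qq mul0r.
Qed.

End QuantumParameter.

Section QCommutators.
Variables (F : fieldType) (q : F) (A : algType F).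
Hypothesis q_neq0 : q != 0.
Implicit Types (x y u v z : A) (a b c p : F).

Definition qcom c x y : A := x * y - c *: (y * x).

Lemma qcomDl c x x' y : qcom c (x + x') y = qcom c x y + qcom c x' y.
Proof. rewrite /qcom mulrDl mulrDr; lin F; ring. Qed.

Lemma qcomDr c x y y' : qcom c x (y + y') = qcom c x y + qcom c x y'.
Proof. rewrite /qcom mulrDl mulrDr; lin F; ring. Qed.

Lemma qcomZr c a x y : qcom c x (a *: y) = a *: qcom c x y.
Proof. rewrite /qcom -scalerAl -scalerAr; lin F; ring. Qed.

Lemma qcom_eq0 c x y : x * y = c *: (y * x) -> qcom c x y = 0.
Proof. by rewrite /qcom => ->; rewrite subrr. Qed.

Lemma qcomE c p x v : v * x = p *: (x * v) -> qcom c x v = (1 - c * p) *: (x * v).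
Proof. by rewrite /qcom => ->; lin F; ring. Qed.

Lemma qcom_mull c p x v :
  v * x = p *: (x * v) -> qcom c x (x * v) = (1 - c * p) *: (x * x * v).
Proof. by move=> vx; rewrite /qcom -!mulrA vx -!scalerAr; lin F; ring. Qed.

Lemma qcom_mulr b c x z v : b != 0 -> z * x = b *: (x * z) ->
  qcom c z (x * v) = b *: (x * qcom (c / b) z v).
Proof.
move=> b0 zx; rewrite /qcom mulrA zx -scalerAl mulrDr mulrN -scalerAr !mulrA.
by lin F; field.
Qed.

Lemma qcomC a b c z u v : z * u = a *: (u * z) -> z * v = b *: (v * z) ->
  z * qcom c u v = (a * b) *: (qcom c u v * z).
Proof.
move=> zu zv; rewrite /qcom mulrDr mulrN mulrDl mulNr -scalerAr -scalerAl.
rewrite !mulrA zu zv -!scalerAl -!mulrA zu zv -!scalerAr; lin F; ring.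
Qed.

Definition qserre x y : A :=
  x * x * x * y + (-1) *: (qthree q *: (x * x * y * x))
   + qthree q *: (x * y * x * x) + (-1) *: (y * x * x * x).

(* The Serre polynomial factors because left and right multiplication by x commute:
   L^3 - [3] L^2 R + [3] L R^2 - R^3 = (L - q^2 R) (L - R) (L - q^-2 R). *)
Lemma qserreE x y : qserre x y = qcom (q ^+ 2) x (qcom 1 x (qcom (q ^- 2) x y)).
Proof.
rewrite /qserre /qcom !(mulrBr, mulrBl) -!(scalerAl, scalerAr).
rewrite !(mulrBr, mulrBl) -!(scalerAl, scalerAr) !mulrA.
by lin F; rewrite /qthree; field.
Qed.

(** The three factors of [qserreE] are applied from the inside out. Most mixed terms vanish at once;
    the others are multiples of [x * x * v1] and [x * v2], whose coefficients add up to zero. *)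
Lemma qserreD x x' y y' :
  x' * x = q ^+ 2 *: (x * x') -> x' * y = q ^- 2 *: (y * x') ->
  y' * x = q ^- 2 *: (x * y') ->
  qserre (x + x') (y + y') = qserre x y + qserre x' y'.
Proof.
move=> xx xy yx; rewrite !qserreE qcomDr (qcomDl _ x x' y) (qcomDl _ x x' y').
rewrite (qcom_eq0 xy) addr0 (qcomE _ yx).
(* The first factor leaves [u1], [v1] and a multiple of [x * y']. The weights now cancel: [x']
   commutes with [u1], and [x] with [v1]. *)
set u1 := qcom _ x y; set v1 := qcom _ x' y'.
have xu1 : x' * u1 = 1 *: (u1 * x').
  by rewrite (qcomC _ xx xy) divff// expf_neq0.
have xx' : x * x' = q ^- 2 *: (x' * x).
  by rewrite xx scalerA mulVf ?expf_neq0// scale1r.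
have xv1 : x * v1 = 1 *: (v1 * x).
  have yx' : x * y' = q ^+ 2 *: (y' * x).
    by rewrite yx scalerA divff ?expf_neq0// scale1r.
  by rewrite (qcomC _ xx' yx') mulVf// expf_neq0.
have v1x : v1 * x = 1 *: (x * v1) by rewrite xv1 !scale1r.
rewrite (qcomDr 1 _ u1) (qcomDr 1 _ _ v1) qcomZr !(qcomDl 1 x x') (qcom_eq0 xu1) addr0.
rewrite (qcomE 1 v1x) (qcom_mull 1 yx).
rewrite (qcom_mulr 1 _ (expf_neq0 2 q_neq0) xx) div1r -/v1.
(* The second factor leaves [u2], [v2] and multiples of [x * x * y'] and [x * v1]. *)
set u2 := qcom 1 x u1; set v2 := qcom 1 x' v1.
have xu2 : x' * u2 = q ^+ 2 *: (u2 * x').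
  by rewrite (qcomC _ xx xu1) mulr1.
have v2x : v2 * x = q ^+ 2 *: (x * v2).
  have := qcomC _ xx' xv1; rewrite -/v2 mulr1 => ->.
  by rewrite scalerA divff ?expf_neq0// scale1r.
have yx2 : (x * y') * x = q ^- 2 *: (x * (x * y')) by rewrite -mulrA yx -scalerAr.
rewrite mulr1 subrr scale0r add0r.
rewrite (qcomDr _ _ u2) (qcomDr _ _ _ v2) qcomZr (qcomDr _ _ (_ *: _)) !qcomZr.
rewrite !(qcomDl (q ^+ 2) x x') (qcom_eq0 xu2).
rewrite (qcomE _ v2x) -(mulrA x x y') (qcom_mull _ yx2).
rewrite (qcom_mull _ v1x) !(qcom_mulr _ _ (expf_neq0 2 q_neq0) xx).
rewrite divff ?expf_neq0// div1r -/v1 -/v2 -!scalerAr !mulrA.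
(* Here the coefficients of [x * x * v1] and of [x * v2] are seen to be zero. *)
by lin F; field.
Qed.

End QCommutators.

(** * The coproduct of the quantum affine algebra *)

Section TensorUq.
Variables (F : fieldType) (q : F).
Local Notation A := (Uq q).
Local Notation "a '⊗' b" := (tens a b : UqUq q) (at level 40).
Implicit Types a b c d : A.


Local Notation TR := (@tensor_relation F A A).
Local Notation pi := (\pi_(presented TR)%qT).
Let gl a : UqUq q := gen TR (inl a).
Let gr b : UqUq q := gen TR (inr b).

Let rel t u : TR t u -> pi t = pi u.
Proof. by move=> tu; apply/presentedP/cong_rel. Qed.

Let glM a c : gl (a * c) = gl a * gl c.
Proof. by rewrite /gl/gen (rel (@tensor_lM F A A _ _)) pi_Mul. Qed.
Let grM a c : gr (a * c) = gr a * gr c.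
Proof. by rewrite /gr/gen (rel (@tensor_rM F A A _ _)) pi_Mul. Qed.
Let glD a c : gl (a + c) = gl a + gl c.
Proof. by rewrite /gl/gen (rel (@tensor_lD F A A _ _)) pi_Add. Qed.
Let grD a c : gr (a + c) = gr a + gr c.
Proof. by rewrite /gr/gen (rel (@tensor_rD F A A _ _)) pi_Add. Qed.
Let glZ (c : F) a : gl (c *: a) = c *: gl a.
Proof. by rewrite /gl/gen (rel (@tensor_lZ F A A _ _)) pi_Scale. Qed.
Let grZ (c : F) a : gr (c *: a) = c *: gr a.
Proof. by rewrite /gr/gen (rel (@tensor_rZ F A A _ _)) pi_Scale. Qed.
Let gl1 : gl 1 = 1.
Proof. by rewrite /gl/gen (rel (@tensor_l1 F A A)). Qed.
Let gr1 : gr 1 = 1.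
Proof. by rewrite /gr/gen (rel (@tensor_r1 F A A)). Qed.
Let glrC a b : gl a * gr b = gr b * gl a.
Proof.
rewrite -[LHS]/(pmul (gl a) (gr b)) -[RHS]/(pmul (gr b) (gl a)) /gl /gr /gen.
by rewrite -!pi_Mul; apply/rel/tensor_comm.
Qed.

Lemma tensM a b c d : a ⊗ b * (c ⊗ d) = (a * c) ⊗ (b * d).
Proof.
change (gl a * gr b * (gl c * gr d) = gl (a * c) * gr (b * d)).
by rewrite glM grM !mulrA -(mulrA _ (gr b)) -glrC !mulrA.
Qed.

Lemma tensDl a b c : (a + c) ⊗ b = a ⊗ b + c ⊗ b.
Proof. by change (gl (a + c) * gr b = gl a * gr b + gl c * gr b); rewrite glD mulrDl. Qed.

Lemma tensDr a b c : a ⊗ (b + c) = a ⊗ b + a ⊗ c.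
Proof. by change (gl a * gr (b + c) = gl a * gr b + gl a * gr c); rewrite grD mulrDr. Qed.

Lemma tensZl (k : F) a b : (k *: a) ⊗ b = k *: (a ⊗ b).
Proof. by change (gl (k *: a) * gr b = k *: (gl a * gr b)); rewrite glZ scalerAl. Qed.

Lemma tensZr (k : F) a b : a ⊗ (k *: b) = k *: (a ⊗ b).
Proof. by change (gl a * gr (k *: b) = k *: (gl a * gr b)); rewrite grZ scalerAr. Qed.

Lemma tensBl a b c : (a - c) ⊗ b = a ⊗ b - c ⊗ b.
Proof. by rewrite -!scaleN1r tensDl tensZl. Qed.

Lemma tensBr a b c : a ⊗ (b - c) = a ⊗ b - a ⊗ c.
Proof. by rewrite -!scaleN1r tensDr tensZr. Qed.

Lemma tens11 : 1 ⊗ 1 = 1.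
Proof. by change (gl 1 * gr 1 = 1); rewrite gl1 gr1 mulr1. Qed.

End TensorUq.

Lemma commute_inv (F : fieldType) (A : algType F) (k kV x : A) (c : F) :
  c != 0 -> k * kV = 1 -> kV * k = 1 -> k * x = c *: (x * k) ->
  kV * x = c^-1 *: (x * kV).
Proof.
move=> c0 kkV kVk kx; apply: (scalerI c0); rewrite scalerA divff// scale1r.
rewrite -[RHS]mul1r -kVk -mulrA [k * (_ * _)]mulrA kx -scalerAl -mulrA kkV.
by rewrite mulr1 scalerAr.
Qed.

(** In a tensor factor whose entries commute, the four words of the Serre polynomial coincide, and
    the polynomial survives in the other factor. The tuple serves as one rewrite rule. *)
Lemma cube_commute (A : pzRingType) (b d : A) : b * d = d * b ->
  (b * b * d * b = b * b * b * d) * (b * d * b * b = b * b * b * d)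
  * (d * b * b * b = b * b * b * d).
Proof.
move=> bd; have bbdb : b * b * d * b = b * b * b * d by rewrite -mulrA -bd !mulrA.
have bdbb : b * d * b * b = b * b * b * d by rewrite -(mulrA b d) -bd !mulrA bbdb.
by rewrite -bd.
Qed.

(** * Relations among the generators and their images under the coproduct *)

Section UqRelations.
Variables (F : fieldType) (q : F).
Local Notation A := (Uq q).
Local Notation gens := (gen (Uq_relation q) : Uq_generator -> A).

(** Evaluating a term at the generators is the quotient map itself, so every defining relation
    becomes an equation in the algebra. *)
Let gen_satisfies : satisfies (Uq_relation q) gens.
Proof.
have evalE (t : term F Uq_generator) : eval gens t = \pi_A%qT t.
  elim: t => [x|||t IHt u IHu|t IHt u IHu|c t IHt] //=; rewrite IHt ?IHu.
  - by rewrite pi_Add.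
  - by rewrite pi_Mul.
  - by rewrite pi_Scale.
by move=> t u tu; rewrite !evalE; apply/presentedP/cong_rel.
Qed.

Lemma ki_kiV i : ki q i * kiV q i = 1.
Proof. exact: (gen_satisfies (Uq_kkV q i)). Qed.

Lemma kiV_ki i : kiV q i * ki q i = 1.
Proof. exact: (gen_satisfies (Uq_kVk q i)). Qed.

Lemma kiC i j : ki q i * ki q j = ki q j * ki q i.
Proof. exact: (gen_satisfies (Uq_kk q i j)). Qed.

Lemma ki_xip i j : ki q i * xip q j = q ^ cartan i j *: (xip q j * ki q i).
Proof. exact: (gen_satisfies (Uq_kxip q i j)). Qed.

Lemma ki_xim i j : ki q i * xim q j = q ^ (- cartan i j) *: (xim q j * ki q i).
Proof. exact: (gen_satisfies (Uq_kxim q i j)). Qed.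

Lemma xip_xim i j : xip q i * xim q j - xim q j * xip q i =
  ((i == j)%:R / (q - q^-1)) *: (ki q i - kiV q i).
Proof. by have := gen_satisfies (Uq_xipxim q i j); rewrite /= !scaleN1r. Qed.

Lemma qserre_xip i j : i != j -> qserre q (xip q i) (xip q j) = 0.
Proof. by move=> ij; have := gen_satisfies (Uq_serre_p q ij). Qed.

Lemma qserre_xim i j : i != j -> qserre q (xim q i) (xim q j) = 0.
Proof. by move=> ij; have := gen_satisfies (Uq_serre_m q ij). Qed.

Hypothesis q_neq0 : q != 0.
Let qz_neq0 n : q ^ n != 0. Proof. exact: expfz_neq0. Qed.

Lemma kiV_xip i j : kiV q i * xip q j = q ^ (- cartan i j) *: (xip q j * kiV q i).
Proof. rewrite -invr_expz; exact: commute_inv (qz_neq0 _) (ki_kiV i) (kiV_ki i) (ki_xip i j). Qed.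

Lemma kiV_xim i j : kiV q i * xim q j = q ^ cartan i j *: (xim q j * kiV q i).
Proof.
rewrite -[cartan i j]opprK -invr_expz.
exact: commute_inv (qz_neq0 _) (ki_kiV i) (kiV_ki i) (ki_xim i j).
Qed.

Lemma kiVC i j : kiV q i * ki q j = ki q j * kiV q i.
Proof.
have := @commute_inv _ _ _ _ (ki q j) _ (oner_neq0 F) (ki_kiV i) (kiV_ki i).
by rewrite invr1 !scale1r; apply; rewrite kiC.
Qed.

Lemma kiVCV i j : kiV q i * kiV q j = kiV q j * kiV q i.
Proof.
have := @commute_inv _ _ _ _ (kiV q j) _ (oner_neq0 F) (ki_kiV i) (kiV_ki i).
by rewrite invr1 !scale1r; apply; rewrite kiVC.
Qed.

Let UU := UqUq q.

Let tens0l (a : A) : tens 0 a = 0 :> UU.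
Proof. by rewrite -(scale0r 0) tensZl scale0r. Qed.

Let tens0r (a : A) : tens a 0 = 0 :> UU.
Proof. by rewrite -(scale0r 0) tensZr scale0r. Qed.

Let qserre_tensl (a b c d : A) : b * d = d * b ->
  qserre q (A := UqUq q) (tens a b) (tens c d) =
  tens (qserre q a c) (b * b * b * d).
Proof.
move=> bd; rewrite /qserre !tensM !tensDl !tensZl.
by rewrite !(@cube_commute _ b d).
Qed.

Let qserre_tensr (a b c d : A) : a * c = c * a ->
  qserre q (A := UqUq q) (tens a b) (tens c d) =
  tens (a * a * a * c) (qserre q b d).
Proof.
move=> ac; rewrite /qserre !tensM !tensDr !tensZr.
by rewrite !(@cube_commute _ a c).
Qed.

Lemma coproduct_gen_satisfies : satisfies (Uq_relation q) (@coproduct_gen F q).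
Proof.
have cartanC i j : cartan i j = cartan j i by rewrite /cartan eq_sym.
have cartan2 i : cartan i i = 2 by rewrite /cartan eqxx.
have cartanN2 i j : i != j -> cartan i j = -2 by rewrite /cartan => /negbTE->.
move=> _ _ [i|i|i j|i j|i j|i j|i j ij|i j ij]; rewrite /coproduct_gen /=.
- by rewrite !tensM !ki_kiV tens11.
- by rewrite !tensM !kiV_ki tens11.
- by rewrite !tensM !(kiC i j).
- rewrite mulrDl mulrDr scalerDr !tensM !ki_xip mulr1 mul1r tensZl tensZr.
  by rewrite (kiC i j).
- rewrite mulrDl mulrDr scalerDr !tensM !ki_xim mulr1 mul1r tensZl tensZr.
  by rewrite kiVC.
- rewrite !scaleN1r; set d := _ / _.
  (* The mixed products cancel because their powers of [q] agree. For [i = j] the rest telescopes: k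
     ⊗ k - k^-1 ⊗ k^-1 = (k - k^-1) ⊗ k^-1 + k ⊗ (k - k^-1). *)
  transitivity (tens (d *: (ki q i - kiV q i)) (kiV q j)
    + tens (ki q i) (d *: (ki q i - kiV q i)) : UU).
    rewrite -xip_xim tensBl tensBr !mulrDl !mulrDr !tensM !mul1r !mulr1.
    rewrite ki_xim kiV_xip cartanC tensZl tensZr.
    by lin F; ring.
  rewrite /d; case: eqVneq => [->|_].
    by rewrite tensZl tensZr tensBl tensBr; lin F; ring.
  by rewrite mul0r !scale0r -!(scale0r 1) tensZl tensZr !scale0r addr0.
- transitivity (qserre q (A := UqUq q) (tens (xip q i) 1 + tens (ki q i) (xip q i))
    (tens (xip q j) 1 + tens (ki q j) (xip q j))); first by [].
  rewrite qserreD//.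
  + rewrite qserre_tensl// qserre_tensr; last exact: kiC.
    by rewrite qserre_xip// tens0l tens0r addr0.
  + by rewrite !tensM mul1r mulr1 ki_xip cartan2 tensZl.
  + by rewrite !tensM mul1r mulr1 ki_xip cartanN2// tensZl.
  + by rewrite !tensM mul1r mulr1 ki_xip cartanN2 1?eq_sym// tensZl.
- transitivity (qserre q (A := UqUq q) (tens (xim q i) (kiV q i) + tens 1 (xim q i))
    (tens (xim q j) (kiV q j) + tens 1 (xim q j))); first by [].
  (* The summands are exchanged because [tens (xim q i) (kiV q i)] has to play the role of [x'] in
     x' x = q^2 x x'. *)
  rewrite addrC [X in qserre _ _ X]addrC qserreD//.
  + rewrite qserre_tensr// qserre_tensl; last exact: kiVCV.
    by rewrite qserre_xim// tens0l tens0r addr0.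
  + by rewrite !tensM mul1r mulr1 kiV_xim cartan2 tensZr.
  + by rewrite !tensM mul1r mulr1 kiV_xim cartanN2// tensZr.
  + by rewrite !tensM mul1r mulr1 kiV_xim cartanN2 1?eq_sym// tensZr.
Qed.
End UqRelations.

(** * The adjoint action *)

Section SkewCommutation.
Variables (F : fieldType) (A : algType F).
Implicit Types (x y z : A) (c d : F).

Lemma skew_commuteM c d e z x y :
  z * x = c *: (x * z) -> z * y = d *: (y * z) -> e = c * d ->
  z * (x * y) = e *: (x * y * z).
Proof.
by move=> zx zy ->; rewrite mulrA zx -scalerAl -(mulrA x z) zy -scalerAr scalerA mulrA.
Qed.

Lemma skew_commuteB c z x y : z * x = c *: (x * z) -> z * y = c *: (y * z) ->
  z * (x - y) = c *: ((x - y) * z).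
Proof. by move=> zx zy; rewrite mulrBr zx zy mulrBl scalerBr. Qed.

End SkewCommutation.

Section Adjoint.
Variables (F : fieldType) (q : F).
Hypothesis q_neq0 : q != 0.
Local Notation A := (Uq q).
Implicit Types (a b x y z : A) (i j : 'I_2) (c : F).

Let dq := (q - q^-1)^-1.

Lemma ad_xipD i a b : ad_xip i (a + b) = ad_xip i a + ad_xip i b.
Proof. by rewrite /ad_xip mulrDr mulrDl mulrDr; lin F; ring. Qed.

Lemma ad_xipZ i c a : ad_xip i (c *: a) = c *: ad_xip i a.
Proof. by rewrite /ad_xip -!scalerAr -!scalerAl; lin F; ring. Qed.

Lemma ad_ximD i a b : ad_xim i (a + b) = ad_xim i a + ad_xim i b.
Proof. by rewrite /ad_xim mulrDr !mulrDl; lin F; ring. Qed.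

Lemma ad_ximZ i c a : ad_xim i (c *: a) = c *: ad_xim i a.
Proof. by rewrite /ad_xim -!scalerAr -!scalerAl; lin F; ring. Qed.

Lemma ad_xipBZ i c a b : ad_xip i (a - c *: b) = ad_xip i a - c *: ad_xip i b.
Proof. by rewrite -!scaleN1r ad_xipD !ad_xipZ. Qed.

Lemma ad_ximBZ i c a b : ad_xim i (a - c *: b) = ad_xim i a - c *: ad_xim i b.
Proof. by rewrite -!scaleN1r ad_ximD !ad_ximZ. Qed.

Lemma ad_xipMr i a z : GRing.comm (xip q i) z -> ad_xip i (a * z) = ad_xip i a * z.
Proof. by move=> ez; rewrite /ad_xip mulrBl -!mulrA ez. Qed.

Lemma ad_ximMr i a z : GRing.comm (xim q i) z -> GRing.comm (kiV q i) z ->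
  ad_xim i (a * z) = ad_xim i a * z.
Proof. by move=> fz kz; rewrite /ad_xim mulrBl -!mulrA -fz -kz. Qed.

Lemma ki_ad_xip i c x : ki q i * x = c *: (x * ki q i) ->
  ki q i * ad_xip i x = (q ^+ 2 * c) *: (ad_xip i x * ki q i).
Proof.
move=> kx; have ke := ki_xip q i i; rewrite /cartan eqxx in ke.
have kV : ki q i * kiV q i = 1 *: (kiV q i * ki q i).
  by rewrite ki_kiV kiV_ki scale1r.
apply: skew_commuteB.
  by apply: (skew_commuteM (skew_commuteM kV kx erefl) ke); ring.
by apply: (skew_commuteM (skew_commuteM kV ke erefl) kx); ring.
Qed.

Lemma ki_ad_xim i c x : ki q i * x = c *: (x * ki q i) ->
  ki q i * ad_xim i x = (q ^- 2 * c) *: (ad_xim i x * ki q i).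
Proof.
move=> kx; have ke := ki_xim q i i; rewrite /cartan eqxx in ke.
have kV : ki q i * kiV q i = 1 *: (kiV q i * ki q i).
  by rewrite ki_kiV kiV_ki scale1r.
have kk : ki q i * ki q i = 1 *: (ki q i * ki q i) by rewrite scale1r.
apply: skew_commuteB; first by apply: (skew_commuteM kx ke); rewrite mulrC.
apply: (skew_commuteM (skew_commuteM (skew_commuteM ke kk erefl) kx erefl) kV).
by rewrite !mulr1.
Qed.

Lemma ad_xip_xim i a : ad_xip i (ad_xim i a) - ad_xim i (ad_xip i a) =
  dq *: (ki q i * a * kiV q i - kiV q i * a * ki q i).
Proof.
set e := xip q i; set f := xim q i; set k := ki q i; set kV := kiV q i.
have kkV : k * kV = 1 by apply: ki_kiV.
have kVk : kV * k = 1 by apply: kiV_ki.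
have ef : e * f - f * e = dq *: (k - kV).
  by rewrite xip_xim eqxx mul1r.
have kVf : kV * f = q ^+ 2 *: (f * kV).
  by have := kiV_xim q_neq0 i i; rewrite /cartan eqxx.
have kVe : kV * e = q ^- 2 *: (e * kV).
  by have := kiV_xip q_neq0 i i; rewrite /cartan eqxx.
have kVfk : kV * f * k = q ^+ 2 *: f.
  by rewrite kVf -scalerAl -mulrA kVk mulr1.
have kVefk : kV * e * f * k = e * f.
  by rewrite kVe -!scalerAl -!(mulrA e) kVfk -scalerAr scalerA mulVf ?scale1r ?expf_neq0.
(* The terms with [e] and [f] on opposite sides of [a] cancel, which leaves a commutator on each
   side. *)
transitivity ((e * f - f * e) * a * kV - kV * a * (e * f - f * e)).
  rewrite /ad_xip /ad_xim -/e -/f -/k -/kV !(mulrBr, mulrBl) !mulrA.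
  rewrite kVfk kVefk -[f * k * kV]mulrA kkV mulr1 -!(scalerAl).
  by rewrite -!mulrA kVe !mulrA -!scalerAr scalerA divff ?expf_neq0// scale1r !mulrA; lin F; ring.
rewrite ef -!scalerAl -scalerAr !(mulrBr, mulrBl).
by rewrite -[kV * a * kV]mulrA; lin F; ring.
Qed.


Hypothesis dq_neq0 : q - q^-1 != 0.

Lemma ad_xip_xim_weight i c x : c != 0 -> ki q i * x = c *: (x * ki q i) ->
  ad_xip i (ad_xim i x) - ad_xim i (ad_xip i x) = (dq * (c - c^-1)) *: x.
Proof.
move=> c0 kx; have xk : x * ki q i = c^-1 *: (ki q i * x) by rewrite kx scalerK.
rewrite ad_xip_xim -(mulrA (kiV q i)) xk kx -scalerAl -(mulrA x) ki_kiV mulr1.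
by rewrite -kx -scalerAr mulrA kiV_ki mul1r; lin F; ring.
Qed.

Let n := q + q^-1.

(** Here [x] is a lowest weight vector. The middle vector [ad_xip i x] has weight 1, where the
    commutator of the two adjoint operators vanishes, so both steps down contribute the same factor
    [n]. *)
Lemma ad_xim2_xip2 i x : ki q i * x = q ^- 2 *: (x * ki q i) -> ad_xim i x = 0 ->
  ad_xim i (ad_xim i (ad_xip i (ad_xip i x))) = n ^+ 2 *: x.
Proof.
move=> kx fx; have qq := sqr_sub1_neq0 q_neq0 dq_neq0.
have c0 : q ^- 2 != 0 by rewrite invr_eq0 expf_neq0.
have ad0 : ad_xip i 0 = 0 :> A by rewrite -(scale0r 0) ad_xipZ !scale0r.
have := ad_xip_xim_weight c0 kx; rewrite fx ad0 sub0r => /eqP.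
rewrite eqr_oppLR => /eqP fex.
have {}fex : ad_xim i (ad_xip i x) = n *: x.
  by rewrite fex -scaleNr; congr (_ *: _); rewrite /dq /n; field; rewrite ?q_neq0 ?oner_neq0.
have kex : ki q i * ad_xip i x = 1 *: (ad_xip i x * ki q i).
  by rewrite (ki_ad_xip kx) divff ?expf_neq0.
have := ad_xip_xim_weight (oner_neq0 _) kex.
rewrite invr1 subrr mulr0 scale0r => /eqP; rewrite subr_eq0 fex ad_xipZ => /eqP <-.
by rewrite ad_ximZ fex scalerA.
Qed.

(** The same ladder, descended from a highest weight vector. *)
Lemma ad_xip2_xim2 i x : ki q i * x = q ^+ 2 *: (x * ki q i) -> ad_xip i x = 0 ->
  ad_xip i (ad_xip i (ad_xim i (ad_xim i x))) = n ^+ 2 *: x.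
Proof.
move=> kx fx; have qq := sqr_sub1_neq0 q_neq0 dq_neq0.
have ad0 : ad_xim i 0 = 0 :> A by rewrite -(scale0r 0) ad_ximZ !scale0r.
have := ad_xip_xim_weight (expf_neq0 2 q_neq0) kx; rewrite fx ad0 subr0 => fex.
have {}fex : ad_xip i (ad_xim i x) = n *: x.
  by rewrite fex; congr (_ *: _); rewrite /dq /n; field; rewrite ?q_neq0 ?oner_neq0.
have kex : ki q i * ad_xim i x = 1 *: (ad_xim i x * ki q i).
  by rewrite (ki_ad_xim kx) mulVf ?expf_neq0.
have := ad_xip_xim_weight (oner_neq0 _) kex.
rewrite invr1 subrr mulr0 scale0r => /eqP; rewrite subr_eq0 fex ad_ximZ => /eqP ->.
by rewrite ad_xipZ fex scalerA.
Qed.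

Let cartan01 : cartan 0 1 = -2. Proof. by []. Qed.

Lemma ki_xi0p' : ki q 1 * xi0p' q = q ^- 2 *: (xi0p' q * ki q 1).
Proof.
have kV : ki q 1 * kiV q 0 = 1 *: (kiV q 0 * ki q 1) by rewrite kiVC scale1r.
exact: (skew_commuteM kV (ki_xip q 1 0) (esym (mul1r _))).
Qed.

(** The powers of [q] from [ki 1] and [kiV 0] reduce this to the commutation of [xip 0] with
    [xim 1]. *)
Lemma ad_xim_xi0p' : ad_xim 1 (xi0p' q) = 0.
Proof.
rewrite /ad_xim -(mulrA _ _ (xi0p' q)) ki_xi0p' -scalerAr -scalerAl.
rewrite -(mulrA _ (_ * ki _ _)) -(mulrA (xi0p' q)) ki_kiV mulr1 /xi0p'.
have kV := kiV_xim q_neq0 0 1; rewrite cartan01 in kV.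
rewrite [xim _ _ * (_ * _)]mulrA scalerAl -kV -!mulrA -mulrBr xip_xim /=.
by rewrite mul0r scale0r mulr0.
Qed.

Lemma ad_xip_xim0 : ad_xip 1 (xim q 0) = 0.
Proof.
rewrite /ad_xip -!mulrA -mulrBr -opprB xip_xim mul0r scale0r.
by rewrite oppr0 mulr0.
Qed.

End Adjoint.

(** * Equality of the subalgebras generated with [Bminus] and with [Bplus] *)

Section Generators.
Variables (F : fieldType) (q : F).
Hypotheses (q_neq0 : q != 0) (dq_neq0 : q - q^-1 != 0) (qD_neq0 : q + q^-1 != 0).
Local Notation A := (Uq q).
Implicit Types (a b x y z : A).

Lemma generated_by_gen b : generated_by b b.
Proof. by apply: subalgebra_gen; constructor 4; right. Qed.

Lemma generated_by_ki b : generated_by b (ki q 1).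
Proof. by apply: subalgebra_gen; constructor 1. Qed.

Lemma generated_by_kiV b : generated_by b (kiV q 1).
Proof. by apply: subalgebra_gen; constructor 2. Qed.

Lemma generated_by_xip b : generated_by b (xip q 1).
Proof. by apply: subalgebra_gen; constructor 3. Qed.

Lemma generated_by_xim b : generated_by b (xim q 1).
Proof. by apply: subalgebra_gen; constructor 4; left. Qed.

Lemma generated_byB b a c : generated_by b a -> generated_by b c -> generated_by b (a - c).
Proof.
by move=> ba bc; rewrite -scaleN1r; apply: subalgebra_add => //; apply: subalgebra_scale.
Qed.

Lemma generated_by_ad_xip b a : generated_by b a -> generated_by b (ad_xip 1 a).
Proof.
move=> ba; apply: generated_byB; do ?[apply: subalgebra_mul => //];
  by [apply: generated_by_kiV|apply: generated_by_xip].
Qed.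

Lemma generated_by_ad_xim b a : generated_by b a -> generated_by b (ad_xim 1 a).
Proof.
move=> ba; apply: generated_byB; do ?[apply: subalgebra_mul => //];
  by [apply: generated_by_kiV|apply: generated_by_xim|apply: generated_by_ki].
Qed.

Lemma generated_by_sub b b' : generated_by b b' ->
  forall a, generated_by b' a -> generated_by b a.
Proof.
move=> bb' a; elim=> {a} [a||a c _ ba _|a c _ ba _|c a _].
- case=> [->|->|->|[]->] //; first exact: generated_by_ki.
  + exact: generated_by_kiV.
  + exact: generated_by_xip.
  + exact: generated_by_xim.
- exact: subalgebra_one.
- exact: subalgebra_add.
- exact: subalgebra_mul.
- exact: subalgebra_scale.
Qed.

(* z is central, so the adjoint action commutes with right multiplication by z,
   while it does not commute with the right factor ki 0 = z * kiV 1 of Bminus. *)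
Let z := ki q 0 * ki q 1.

Let zP : [/\ GRing.comm (xip q 1) z, GRing.comm (xim q 1) z & GRing.comm (kiV q 1) z].
Proof.
have comm_skew (c d : F) x : ki q 0 * x = c *: (x * ki q 0) ->
    ki q 1 * x = d *: (x * ki q 1) -> c * d = 1 -> GRing.comm x z.
  move=> k0x k1x cd; rewrite /GRing.comm /z -[RHS]mulrA k1x -scalerAr (mulrA _ x) k0x.
  by rewrite -scalerAl scalerA mulrC cd scale1r mulrA.
split.
- by apply: comm_skew (ki_xip _ _ _) (ki_xip _ _ _) _; apply: mulVf; rewrite expf_neq0.
- by apply: comm_skew (ki_xim _ _ _) (ki_xim _ _ _) _; apply: divff; rewrite expf_neq0.
- by apply: (comm_skew 1 1); rewrite ?mulr1// scale1r kiVC.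
Qed.

(** The two products differ by [ki 1], which is invertible inside the subalgebra. *)
Let z_cancel b a : generated_by b (a * z) <-> generated_by b (a * ki q 0).
Proof.
rewrite /z mulrA; split=> ba; last by apply: subalgebra_mul => //; apply: generated_by_ki.
have -> : a * ki q 0 = a * ki q 0 * ki q 1 * kiV q 1 by rewrite -[RHS]mulrA ki_kiV mulr1.
by apply: subalgebra_mul => //; apply: generated_by_kiV.
Qed.

Variables (dm dp : F).
Hypotheses (dm_neq0 : dm != 0) (dpE : dp = dm^-1 * (q + q^-1) ^- 2).

Let n := q + q^-1.
Let x0 := xi0p' q.
Let y0 := xim q 0.
Let ex := ad_xip 1 (ad_xip 1 x0).
Let fy := ad_xim 1 (ad_xim 1 y0).

Let BminusE : Bminus q dm = (y0 - dm *: ex) * ki q 0.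
Proof. by rewrite mulrBl -scalerAl. Qed.

Let BplusE : Bplus q dp = (x0 - dp *: fy) * ki q 0.
Proof. by rewrite mulrBl -scalerAl. Qed.

Let Bplus_in : generated_by (Bminus q dm) (Bplus q dp).
Proof.
have [ez fz kz] := zP; rewrite BplusE; apply/z_cancel.
have : generated_by (Bminus q dm) (ad_xim 1 (ad_xim 1 ((y0 - dm *: ex) * z))).
  do 2!apply: generated_by_ad_xim; apply/z_cancel; rewrite -BminusE.
  exact: generated_by_gen.
rewrite (ad_ximMr (_ - _))// ad_ximMr// (ad_ximBZ 1 _ y0) (ad_ximBZ 1 _ (ad_xim 1 y0)).
rewrite /ex /x0 (ad_xim2_xip2 q_neq0 dq_neq0 (ki_xi0p' q) (ad_xim_xi0p' q_neq0)).
(* Up to the factor [z] the element is [fy - (dm * n ^+ 2) *: x0]. As [dp * dm * n ^+ 2 = 1], the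
   scalar [- dp] turns it into [x0 - dp *: fy]. *)
move=> /(subalgebra_scale (- dp)); congr (generated_by _ _).
rewrite scalerAl; congr (_ * z); rewrite dpE -/fy -/x0.
by move: (q + q^-1) qD_neq0 => m m0; lin F; field; rewrite ?dm_neq0 ?m0.
Qed.

Let Bminus_in : generated_by (Bplus q dp) (Bminus q dm).
Proof.
have [ez fz kz] := zP; rewrite BminusE; apply/z_cancel.
have : generated_by (Bplus q dp) (ad_xip 1 (ad_xip 1 ((x0 - dp *: fy) * z))).
  do 2!apply: generated_by_ad_xip; apply/z_cancel; rewrite -BplusE.
  exact: generated_by_gen.
rewrite (ad_xipMr (_ - _))// ad_xipMr// (ad_xipBZ 1 _ x0) (ad_xipBZ 1 _ (ad_xip 1 x0)).
rewrite /fy /y0 (ad_xip2_xim2 q_neq0 dq_neq0 (ki_xim q 1 0) (ad_xip_xim0 q)).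
move=> /(subalgebra_scale (- dm)); congr (generated_by _ _).
rewrite scalerAl; congr (_ * z); rewrite dpE -/ex -/y0.
by move: (q + q^-1) qD_neq0 => m m0; lin F; field; rewrite ?dm_neq0 ?m0.
Qed.

Lemma generated_by_Bminus_Bplus b :
  generated_by (Bminus q dm) b <-> generated_by (Bplus q dp) b.
Proof. by split; apply: generated_by_sub. Qed.

End Generators.

(** * The coideal property *)

Section Coproduct.
Variables (F : fieldType) (q : F).
Hypothesis q_neq0 : q != 0.
Local Notation A := (Uq q).
Local Notation UU := (UqUq q).
Let sat := coproduct_gen_satisfies q_neq0.

Lemma coproduct1 : coproduct (1 : A) = 1. Proof. exact: extend1 sat. Qed.

Lemma coproductD (a b : A) : coproduct (a + b) = coproduct a + coproduct b.
Proof. exact: (extendD sat). Qed.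

Lemma coproductM (a b : A) : coproduct (a * b) = coproduct a * coproduct b.
Proof. exact: (extendM sat). Qed.

Lemma coproductZ c (a : A) : coproduct (c *: a) = c *: coproduct a.
Proof. exact: (extendZ sat). Qed.

Lemma coproductB (a b : A) : coproduct (a - b) = coproduct a - coproduct b.
Proof. by rewrite -!scaleN1r coproductD coproductZ. Qed.

Lemma coproduct_xip i : coproduct (xip q i) = tens (xip q i) 1 + tens (ki q i) (xip q i).
Proof. exact: (extendE sat). Qed.

Lemma coproduct_xim i : coproduct (xim q i) = tens (xim q i) (kiV q i) + tens 1 (xim q i).
Proof. exact: (extendE sat). Qed.

Lemma coproduct_ki i : coproduct (ki q i) = tens (ki q i) (ki q i).
Proof. exact: (extendE sat). Qed.

Lemma coproduct_kiV i : coproduct (kiV q i) = tens (kiV q i) (kiV q i).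
Proof. exact: (extendE sat). Qed.

Section Span.
Variable S : A -> Prop.
Local Notation B := (subalgebra S).

Definition tensor_span (t : UU) : Prop :=
  exists n (a c : 'I_n -> A), (forall i, B (c i)) /\ t = \sum_i (tens (a i) (c i) : UU).

Lemma tensor_span_tens a c : B c -> tensor_span (tens a c).
Proof. by move=> Bc; exists 1, (fun=> a), (fun=> c); rewrite big_ord1. Qed.

Lemma tensor_spanD t u : tensor_span t -> tensor_span u -> tensor_span (t + u).
Proof.
move=> [n [a [c [Bc ->]]]] [m [a' [c' [Bc' ->]]]].
exists (n + m)%N, (fun k => match split k with inl i => a i | inr j => a' j end),
  (fun k => match split k with inl i => c i | inr j => c' j end).
split=> [k|]; first by case: split.
rewrite big_split_ord; congr (_ + _); apply: eq_bigr => i _.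
  by rewrite (unsplitK (inl i)).
by rewrite (unsplitK (inr i)).
Qed.

Lemma tensor_spanM t u : tensor_span t -> tensor_span u -> tensor_span (t * u).
Proof.
move=> [n [a [c [Bc ->]]]] [m [a' [c' [Bc' ->]]]].
exists (n * m)%N, (fun k => a (mxtens_unindex k).1 * a' (mxtens_unindex k).2),
  (fun k => c (mxtens_unindex k).1 * c' (mxtens_unindex k).2).
split=> [k|]; first exact: subalgebra_mul.
by rewrite mulr_sum; apply: eq_bigr => k _; rewrite tensM.
Qed.

Lemma tensor_spanZ k t : tensor_span t -> tensor_span (k *: t).
Proof.
move=> [n [a [c [Bc ->]]]]; exists n, (fun i => k *: a i), c; split=> //.
by rewrite scaler_sumr; apply: eq_bigr => i _; rewrite tensZl.
Qed.

Lemma tensor_spanB t u : tensor_span t -> tensor_span u -> tensor_span (t - u).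
Proof. by move=> ? ?; rewrite -scaleN1r; apply/tensor_spanD/tensor_spanZ. Qed.

(** The coproduct is an algebra morphism and A ⊗ B is closed under the algebra operations, so
    generators suffice. *)
Lemma subalgebra_left_coideal : (forall a, S a -> tensor_span (coproduct a)) ->
  left_coideal B.
Proof.
move=> BS b; change (B b -> tensor_span (coproduct b)).
elim=> {b} [a /BS//||a c _ Da _ Dc|a c _ Da _ Dc|k a _ Da].
- by rewrite coproduct1 -tens11; apply/tensor_span_tens/subalgebra_one.
- by rewrite coproductD; apply: tensor_spanD.
- by rewrite coproductM; apply: tensor_spanM.
- by rewrite coproductZ; apply: tensor_spanZ.
Qed.

End Span.

Variable dm : F.

(** Only the generator [b] needs work. Its coproduct is [tens (ki q 0) b] plus terms with right
    factors in the subalgebra, because [ad_xip 1] preserves the shape 1 ⊗ a + t of a coproduct with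
    a harmless remainder t. *)
Lemma left_coideal_Bminus : left_coideal (generated_by (Bminus q dm)).
Proof.
set b := Bminus q dm; pose span := @tensor_span
  (fun a => [\/ a = ki q 1, a = kiV q 1, a = xip q 1 | a = xim q 1 \/ a = b]).
have spanT a c : generated_by b c -> span (tens a c) by exact: tensor_span_tens.
have one : generated_by b 1 by exact: subalgebra_one.
have spanE : span (coproduct (xip q 1)).
  rewrite coproduct_xip; apply: tensor_spanD; apply: spanT => //.
  exact: generated_by_xip.
(* kiV 0 is not in the subalgebra: P t says that t is in A (x) B once the factor
   1 (x) ki 0 from the coproduct of ki 0 cancels it. *)
pose P (t : UU) := span (t * tens 1 (ki q 0)).
have eK : xip q 1 * ki q 0 = q ^+ 2 *: (ki q 0 * xip q 1).
  by rewrite ki_xip /= scalerA divff ?scale1r// expf_neq0.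
have PE t : P t -> P (t * coproduct (xip q 1)).
  rewrite /P => Pt.
  have -> : t * coproduct (xip q 1) * tens 1 (ki q 0) = t * tens 1 (ki q 0) *
      (tens (xip q 1) 1 + q ^+ 2 *: tens (ki q 1) (xip q 1)).
    rewrite -!(mulrA t) coproduct_xip; congr (_ * _).
    by rewrite mulrDl mulrDr -scalerAr !tensM !mulr1 !mul1r eK tensZr.
  apply: tensor_spanM => //; apply: tensor_spanD; first exact: spanT.
  by apply/tensor_spanZ/spanT/generated_by_xip.
have PM s t : span s -> P t -> P (s * t).
  by rewrite /P -(mulrA s); apply: tensor_spanM.
(* On [tens 1 a] the two terms with left factor [kiV 1 * xip 1] cancel, and [kiV 1 * ki 1 = 1] makes
   the left factor of the others trivial. *)
have Pad a t : coproduct a = tens 1 a + t -> P t ->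
    exists2 t', coproduct (ad_xip 1 a) = tens 1 (ad_xip 1 a) + t' & P t'.
  move=> Da Pt; set k := tens (kiV q 1) (kiV q 1) : UU.
  have spank : span k by apply/spanT/generated_by_kiV.
  exists (k * t * coproduct (xip q 1) - k * coproduct (xip q 1) * t); last first.
    rewrite /P mulrBl; apply: tensor_spanB.
      by apply: PE; apply: PM.
    by apply: PM => //; apply: tensor_spanM.
  rewrite coproductB !coproductM coproduct_kiV -/k Da !(mulrDl, mulrDr).
  rewrite coproduct_xip /k !(mulrDl, mulrDr) !tensM !mulr1 !kiV_ki tensBr.
  by rewrite !mulrA; lin F; ring.
have [t Dx Pt] : exists2 t, coproduct (xi0p' q) = tens 1 (xi0p' q) + t & P t.
  exists (tens (xi0p' q) (kiV q 0)).
    by rewrite coproductM coproduct_kiV coproduct_xip mulrDr !tensM mulr1 kiV_ki addrC.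
  by rewrite /P tensM kiV_ki mulr1; apply: spanT.
have [t1 Dx1 Pt1] := Pad _ _ Dx Pt.
have [t2 Dx2 Pt2] := Pad _ _ Dx1 Pt1.
apply: subalgebra_left_coideal => a [->|->|->|[]->] //.
- by rewrite coproduct_ki; apply/spanT/generated_by_ki.
- by rewrite coproduct_kiV; apply/spanT/generated_by_kiV.
- rewrite coproduct_xim; apply: tensor_spanD; apply: spanT.
    exact: generated_by_kiV.
  exact: generated_by_xim.
have -> : coproduct b = tens (xim q 0 * ki q 0) 1 + tens (ki q 0) b
    - dm *: (t2 * tens 1 (ki q 0) * tens (ki q 0) 1).
  rewrite /b coproductB coproductZ !coproductM coproduct_ki coproduct_xim Dx2.
  rewrite !mulrDl -mulrA !tensM !mul1r !mulr1 kiV_ki tensBr tensZr.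
  by lin F; ring.
apply: tensor_spanB; first apply: tensor_spanD.
- exact: spanT.
- exact/spanT/generated_by_gen.
by apply/tensor_spanZ/tensor_spanM => //; apply: spanT.
Qed.

End Coproduct.

(** * Evaluation representations *)

Section ExplicitMatrices.
Variable F : fieldType.
Implicit Types (l : seq (seq F)) (c : F).

Definition entry l i j : F := nth 0 (nth [::] l i) j.

(** Matrices given by lists of rows: their sums, products and Kronecker products compute under [/=],
    and an identity splits into one scalar identity per entry. *)
Definition lmx n l : 'M[F]_n := \matrix_(i, j) entry l i j.

Definition ltab n (f : nat -> nat -> F) : seq (seq F) :=
  [seq [seq f i j | j <- iota 0 n] | i <- iota 0 n].

Lemma entry_ltab n f i j : (i < n)%N -> (j < n)%N -> entry (ltab n f) i j = f i j.
Proof.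
move=> ltin ltjn; rewrite /entry (nth_map 0%N) ?size_iota// (nth_map 0%N) ?size_iota//.
by rewrite !nth_iota.
Qed.

Lemma lmxE n f : lmx n (ltab n f) = \matrix_(i, j) f i j.
Proof. by apply/matrixP => i j; rewrite !mxE entry_ltab. Qed.

Lemma lmxD n l l' : lmx n l + lmx n l' = lmx n (ltab n (fun i j => entry l i j + entry l' i j)).
Proof. by rewrite lmxE; apply/matrixP => i j; rewrite !mxE. Qed.

Lemma lmxZ n c l : c *: lmx n l = lmx n (ltab n (fun i j => c * entry l i j)).
Proof. by rewrite lmxE; apply/matrixP => i j; rewrite !mxE. Qed.

Lemma lmxM n l l' : lmx n l *m lmx n l' =
  lmx n (ltab n (fun i j =>
    foldr (fun k s => entry l i k * entry l' k j + s) 0 (iota 0 n))).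
Proof.
rewrite lmxE; apply/matrixP => i j; rewrite !mxE.
under eq_bigr do rewrite !mxE.
by rewrite -(big_mkord xpredT (fun k => entry l i k * entry l' k j)) unlock /index_iota subn0.
Qed.

Lemma lmx1 n : 1%:M = lmx n (ltab n (fun i j => if eqn i j then 1 else 0)).
Proof.
rewrite lmxE; apply/matrixP => i j; rewrite !mxE -val_eqE -[eqn i j]/(val i == val j).
by case: eqP.
Qed.

Lemma lmx_tens m n l l' : lmx m l *t lmx n l' =
  lmx (m * n) (ltab (m * n) (fun i j =>
    entry l (i %/ n) (j %/ n) * entry l' (i %% n) (j %% n))).
Proof. by rewrite lmxE; apply/matrixP => i j; rewrite !mxE. Qed.

Lemma lmx_entries n (M : 'M[F]_n.+1) :
  M = lmx n.+1 (ltab n.+1 (fun i j => M (inord i) (inord j))).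
Proof. by rewrite lmxE; apply/matrixP => i j; rewrite !mxE !inord_val. Qed.

Lemma lmx_inj n l l' i j : lmx n l = lmx n l' -> (i < n)%N -> (j < n)%N ->
  entry l i j = entry l' i j.
Proof. by move=> /matrixP ll' lti ltj; have := ll' (Ordinal lti) (Ordinal ltj); rewrite !mxE. Qed.

Lemma lmx_eq0 n l i j : lmx n l = 0 -> (i < n)%N -> (j < n)%N -> entry l i j = 0.
Proof. by move=> /matrixP l0 lti ltj; have := l0 (Ordinal lti) (Ordinal ltj); rewrite !mxE. Qed.

End ExplicitMatrices.

Ltac lmx_norm := rewrite /ltab /entry /=.

Ltac lmx_eq := apply: (congr1 (lmx _)); lmx_norm;
  repeat apply: (f_equal2 cons); try reflexivity.

Lemma ord2P (i : 'I_2) : (i = 0) + (i = 1).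
Proof. by case: i => [[|[|//]]] ?; [left|right]; apply: val_inj. Qed.

Section Evaluation.
Variables (F : fieldType) (q : F).
Hypotheses (q_neq0 : q != 0) (dq_neq0 : q - q^-1 != 0).

Lemma delta2E (i j : 'I_2) : delta_mx i j = lmx 2 (ltab 2 (fun k l =>
  if eqn k i && eqn l j then 1 else 0)) :> 'M[F]_2.
Proof.
rewrite lmxE; apply/matrixP => k l; rewrite !mxE -!val_eqE.
by rewrite -[eqn k i]/(val k == val i) -[eqn l j]/(val l == val j); case: ifP.
Qed.

Variable z : F.
Hypothesis z_neq0 : z != 0.
Local Notation ev := (evaluation_gen q z).

Lemma evaluation_genE :
  (ev (Gxip 0) = lmx 2 [:: [:: 0; 0]; [:: z; 0]]) *
  (ev (Gxip 1) = lmx 2 [:: [:: 0; 1]; [:: 0; 0]]) *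
  (ev (Gxim 0) = lmx 2 [:: [:: 0; z^-1]; [:: 0; 0]]) *
  (ev (Gxim 1) = lmx 2 [:: [:: 0; 0]; [:: 1; 0]]) *
  (ev (Gk 0) = lmx 2 [:: [:: q^-1; 0]; [:: 0; q]]) *
  (ev (Gk 1) = lmx 2 [:: [:: q; 0]; [:: 0; q^-1]]) *
  (ev (GkV 0) = lmx 2 [:: [:: q; 0]; [:: 0; q^-1]]) *
  (ev (GkV 1) = lmx 2 [:: [:: q^-1; 0]; [:: 0; q]]).
Proof.
by do !split; rewrite /= !delta2E ?lmxZ ?lmxD; lmx_eq; ring.
Qed.

Lemma evaluation_gen_satisfies : satisfies (Uq_relation q) ev.
Proof.
have qq := sqr_sub1_neq0 q_neq0 dq_neq0.
have mE (a b : 'M[F]_2) : a * b = a *m b by [].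
have one2 : 1 = lmx 2 [:: [:: 1; 0]; [:: 0; 1]] :> 'M[F]_2 by rewrite -[1]/(1%:M) lmx1.
have zero2 : 0 = lmx 2 [:: [:: 0; 0]; [:: 0; 0]] :> 'M[F]_2.
  by rewrite -(scale0r 1) one2 lmxZ; lmx_eq; ring.
have cE : (q ^ cartan 0 0 = q ^+ 2) * (q ^ cartan 1 1 = q ^+ 2) *
    (q ^ cartan 0 1 = q ^- 2) * (q ^ cartan 1 0 = q ^- 2) by [].
have cNE : (q ^ (- cartan 0 0) = q ^- 2) * (q ^ (- cartan 1 1) = q ^- 2) *
    (q ^ (- cartan 0 1) = q ^+ 2) * (q ^ (- cartan 1 0) = q ^+ 2) by [].
move=> _ _ [i|i|i j|i j|i j|i j|i j ij|i j ij]; cbn [eval serre].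
all: have [iE|iE] := ord2P i; subst i.
all: try (have [jE|jE] := ord2P j; subst j; try by rewrite eqxx in ij).
all: rewrite ?evaluation_genE ?mE ?one2 ?zero2 ?cNE ?cE ?(lmxM, lmxD, lmxZ) /=.
all: try (by lmx_eq; rewrite /qthree; field; rewrite ?q_neq0 ?z_neq0 ?qq ?oner_neq0).
Qed.

End Evaluation.

Section TensorMatrices.
Variables (F : fieldType) (m n : nat).
Implicit Types (A : 'M[F]_m) (B : 'M[F]_n).

Lemma tensmxDl A A' B : (A + A') *t B = A *t B + A' *t B.
Proof. by apply/matrixP => i j; rewrite !mxE mulrDl. Qed.

Lemma tensmxDr A B B' : A *t (B + B') = A *t B + A *t B'.
Proof. by apply/matrixP => i j; rewrite !mxE mulrDr. Qed.

Lemma tensmxZl c A B : (c *: A) *t B = c *: (A *t B).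
Proof. by apply/matrixP => i j; rewrite !mxE mulrA. Qed.

Lemma tensmxZr c A B : A *t (c *: B) = c *: (A *t B).
Proof. by apply/matrixP => i j; rewrite !mxE mulrCA. Qed.

Lemma tensmx11 : (1%:M : 'M[F]_m) *t (1%:M : 'M[F]_n) = 1%:M.
Proof.
apply/matrixP => i j; case: (mxtens_indexP i) => i1 i2; case: (mxtens_indexP j) => j1 j2.
rewrite tensmxE !mxE (can_eq (@mxtens_indexK _ _)) xpair_eqE -natrM.
by case: eqP; case: eqP.
Qed.

End TensorMatrices.

(** * The action on V ⊗ W through the coproduct *)

Section Representation.
Variables (F : fieldType) (q : F).
Hypotheses (q_neq0 : q != 0) (dq_neq0 : q - q^-1 != 0).
Variables z s : F.
Hypotheses (z_neq0 : z != 0) (s_neq0 : s != 0).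
Local Notation A := (Uq q).
Let satz := evaluation_gen_satisfies q_neq0 dq_neq0 z_neq0.
Let sats := evaluation_gen_satisfies q_neq0 dq_neq0 s_neq0.

Let tensmx2M (a b c d : 'M[F]_2) :
  (a *t c : 'M[F]_4) * (b *t d : 'M[F]_4) = (a *m b) *t (c *m d).
Proof. exact (tensmx_mul a c b d). Qed.

Let ev2_sat : satisfies (@tensor_relation F A A)
  (fun x : A + A => match x with
     | inl a => evaluation z a *t (1%:M : 'M[F]_2) : 'M[F]_4
     | inr b => (1%:M : 'M[F]_2) *t evaluation s b
     end).
Proof.
move=> _ _ [|a b|a b|c a||a b|a b|c a|a b] /=.
- by rewrite /evaluation (extend1 satz) tensmx11.
- by rewrite /evaluation (extendD satz) tensmxDl.
- by rewrite /evaluation (extendM satz) tensmx2M mulmx1.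
- by rewrite /evaluation (extendZ satz) tensmxZl.
- by rewrite /evaluation (extend1 sats) tensmx11.
- by rewrite /evaluation (extendD sats) tensmxDr.
- by rewrite /evaluation (extendM sats) tensmx2M mulmx1.
- by rewrite /evaluation (extendZ sats) tensmxZr.
- by rewrite !tensmx2M !mulmx1 !mul1mx.
Qed.

Definition rho (b : A) : 'M[F]_(2 * 2) := evaluation2 z s (coproduct b).

Lemma rho1 : rho 1 = 1%:M.
Proof. by rewrite /rho coproduct1//; apply: (extend1 ev2_sat). Qed.

Lemma rhoD a b : rho (a + b) = rho a + rho b.
Proof. by rewrite /rho coproductD//; apply: (extendD ev2_sat). Qed.

Lemma rhoM a b : rho (a * b) = rho a *m rho b.
Proof. by rewrite /rho coproductM//; apply: (extendM ev2_sat). Qed.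

Lemma rhoZ c b : rho (c *: b) = c *: rho b.
Proof. by rewrite /rho coproductZ//; apply: (extendZ ev2_sat). Qed.

Lemma rhoB a b : rho (a - b) = rho a - rho b.
Proof. by rewrite -!scaleN1r rhoD rhoZ. Qed.

Lemma evaluation2_tens a b :
  evaluation2 z s (tens a b : UqUq q) = evaluation z a *t evaluation s b.
Proof.
rewrite /evaluation2 /tensor_map (extendM ev2_sat) !(extendE ev2_sat).
by rewrite tensmx2M mulmx1 mul1mx.
Qed.

Lemma evaluation2D (t u : UqUq q) :
  evaluation2 z s (t + u) = evaluation2 z s t + evaluation2 z s u.
Proof. exact: (extendD ev2_sat). Qed.


Let ev_gen g : evaluation z (gen (Uq_relation q) g : A) = evaluation_gen q z g.
Proof. exact: (extendE satz). Qed.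

Let ev_gens g : evaluation s (gen (Uq_relation q) g : A) = evaluation_gen q s g.
Proof. exact: (extendE sats). Qed.

Let ev1 : evaluation z (1 : A) = lmx 2 [:: [:: 1; 0]; [:: 0; 1]].
Proof. by rewrite [LHS](extend1 satz) -[LHS]/(1%:M) lmx1. Qed.

Let ev1s : evaluation s (1 : A) = lmx 2 [:: [:: 1; 0]; [:: 0; 1]].
Proof. by rewrite [LHS](extend1 sats) -[LHS]/(1%:M) lmx1. Qed.

Local Notation mx4 := (lmx (2 * 2)).

Lemma rho_genE :
  (rho (xip q 0) = mx4 [:: [:: 0; 0; 0; 0]; [:: s / q; 0; 0; 0];
                           [:: z; 0; 0; 0]; [:: 0; z; q * s; 0]]) *
  (rho (xip q 1) = mx4 [:: [:: 0; q; 1; 0]; [:: 0; 0; 0; 1];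
                           [:: 0; 0; 0; q^-1]; [:: 0; 0; 0; 0]]) *
  (rho (xim q 0) = mx4 [:: [:: 0; s^-1; q / z; 0]; [:: 0; 0; 0; (q * z)^-1];
                           [:: 0; 0; 0; s^-1]; [:: 0; 0; 0; 0]]) *
  (rho (xim q 1) = mx4 [:: [:: 0; 0; 0; 0]; [:: 1; 0; 0; 0];
                           [:: q^-1; 0; 0; 0]; [:: 0; q; 1; 0]]) *
  (rho (ki q 0) = mx4 [:: [:: q ^- 2; 0; 0; 0]; [:: 0; 1; 0; 0];
                          [:: 0; 0; 1; 0]; [:: 0; 0; 0; q ^+ 2]]) *
  (rho (ki q 1) = mx4 [:: [:: q ^+ 2; 0; 0; 0]; [:: 0; 1; 0; 0];
                          [:: 0; 0; 1; 0]; [:: 0; 0; 0; q ^- 2]]) *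
  (rho (kiV q 0) = mx4 [:: [:: q ^+ 2; 0; 0; 0]; [:: 0; 1; 0; 0];
                           [:: 0; 0; 1; 0]; [:: 0; 0; 0; q ^- 2]]) *
  (rho (kiV q 1) = mx4 [:: [:: q ^- 2; 0; 0; 0]; [:: 0; 1; 0; 0];
                           [:: 0; 0; 1; 0]; [:: 0; 0; 0; q ^+ 2]]).
Proof.
rewrite /rho !(coproduct_xip, coproduct_xim, coproduct_ki, coproduct_kiV)//.
rewrite !(evaluation2D, evaluation2_tens) !(ev_gen, ev_gens, ev1, ev1s).
rewrite !evaluation_genE !lmx_tens.
by do !split; rewrite ?lmxD; lmx_eq; field; rewrite ?q_neq0 ?z_neq0 ?s_neq0 ?oner_neq0.
Qed.

Let rho_ad a : rho (ad_xip 1 a) =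
  rho (kiV q 1) *m rho a *m rho (xip q 1) - rho (kiV q 1) *m rho (xip q 1) *m rho a.
Proof. by rewrite rhoB !rhoM. Qed.

Let rho_xi0p' : rho (xi0p' q) = mx4
  [:: [:: 0; 0; 0; 0]; [:: s / q; 0; 0; 0];
      [:: z; 0; 0; 0]; [:: 0; z / q ^+ 2; s / q; 0]].
Proof.
rewrite rhoM !rho_genE !lmxM /=.
by lmx_eq; field; rewrite ?q_neq0 ?z_neq0 ?s_neq0 ?oner_neq0.
Qed.

Let rho_ad1 : rho (ad_xip 1 (xi0p' q)) = mx4
  [:: [:: - (s + z) / q ^+ 2; 0; 0; 0]; [:: 0; s - z / q ^+ 2; 0; 0];
      [:: 0; q * z - z / q ^+ 3; z - s / q ^+ 2; 0]; [:: 0; 0; 0; s + z]].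
Proof.
rewrite rho_ad rho_xi0p' !rho_genE -scaleN1r !lmxM !lmxZ !lmxD /=.
by lmx_eq; field; rewrite ?q_neq0 ?z_neq0 ?s_neq0 ?oner_neq0.
Qed.

Let rho_ad2 : rho (ad_xip 1 (ad_xip 1 (xi0p' q))) = mx4
  [:: [:: 0; z / q ^+ 5 - s / q ^+ 3 - s / q - z / q; - z / q ^+ 4 - z / q ^+ 2; 0];
      [:: 0; 0; 0; - z / q ^+ 2 - z];
      [:: 0; 0; 0; - s / q ^+ 3 - z / q ^+ 3 - s / q + q * z]; [:: 0; 0; 0; 0]].
Proof.
rewrite rho_ad rho_ad1 !rho_genE -scaleN1r !lmxM !lmxZ !lmxD /=.
by lmx_eq; field; rewrite ?q_neq0 ?z_neq0 ?s_neq0 ?oner_neq0.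
Qed.

(** The prescribed [dm] gives [s] the same coefficient as [s^-1], so the matrix depends on [s] only
    through [s + s^-1]. *)
Lemma rho_Bminus dm : q + q^-1 != 0 -> q ^- 2 * dm = (q + q^-1)^-1 ->
  rho (Bminus q dm) = mx4
  [:: [:: 0; s + s^-1 + (1 - q ^- 2) * z; q / z + z / q; 0];
      [:: 0; 0; 0; q / z + q ^+ 3 * z];
      [:: 0; 0; 0; q ^+ 2 * (s + s^-1 + (1 - q ^+ 2) * z)]; [:: 0; 0; 0; 0]].
Proof.
move=> qD_neq0 dmE; have {dmE} -> : dm = q ^+ 2 * (q + q^-1)^-1.
  by rewrite -dmE mulrA divff ?mul1r// expf_neq0.
have qq := sqr_add1_neq0 q_neq0 qD_neq0.
rewrite rhoB rhoZ !rhoM rho_ad2 !rho_genE -scaleN1r !lmxM !lmxZ !lmxD /=.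
by lmx_eq; field; rewrite ?q_neq0 ?z_neq0 ?s_neq0 ?oner_neq0 ?qq.
Qed.

End Representation.

(** * The K-matrix *)

Section KMatrix.
Variables (F : fieldType) (q : F).
Hypotheses (q_neq0 : q != 0) (dq_neq0 : q - q^-1 != 0) (qD_neq0 : q + q^-1 != 0).
Variables (dm s : F).
Hypotheses (s_neq0 : s != 0) (dmE : q ^- 2 * dm = (q + q^-1)^-1).
Local Notation A := (Uq q).
Local Notation B := (generated_by (Bminus q dm)).
Local Notation mx4 := (lmx (2 * 2)).

Let qB : q * q - 1 != 0. Proof. exact: sqr_sub1_neq0. Qed.

Let qD : q * q + 1 != 0. Proof. exact: sqr_add1_neq0. Qed.

(** Equal to -(q + q^-1) times the projection onto the trivial representation of U_q(sl_2), which
    v_1 ⊗ v_2 - q v_2 ⊗ v_1 spans. *)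
Definition TL : 'M[F]_(2 * 2) := mx4
  [:: [:: 0; 0; 0; 0]; [:: 0; - q^-1; 1; 0]; [:: 0; 1; - q; 0]; [:: 0; 0; 0; 0]].

(* Every solution is a + b * TL with a * KTL z = b * Kone z; the coefficients below
   are those of the solution that is polynomial in s, z and their inverses. *)
Definition Kone (z : F) : F := q ^+ 2 * z + q ^- 2 * z^-1 - s - s^-1.
Definition KTL (z : F) : F := (q - q^-1) * (z - z^-1).
Definition Kmatrix (z : F) : 'M[F]_(2 * 2) := Kone z *: 1%:M + KTL z *: TL.

Variable z : F.
Hypothesis z_neq0 : z != 0.
Let zV_neq0 : z^-1 != 0. Proof. by rewrite invr_eq0. Qed.

(** Both actions are algebra morphisms, so generators suffice; the condition for [kiV 1] follows by
    inverting that for [ki 1]. *)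
Lemma intertwinesP (N : 'M[F]_(2 * 2)) : intertwines B s z N <->
  [/\ rho z^-1 s (ki q 1) *m N = N *m rho z s (ki q 1),
      rho z^-1 s (xip q 1) *m N = N *m rho z s (xip q 1),
      rho z^-1 s (xim q 1) *m N = N *m rho z s (xim q 1) &
      rho z^-1 s (Bminus q dm) *m N = N *m rho z s (Bminus q dm)].
Proof.
have rM := rhoM q_neq0 dq_neq0 _ s_neq0.
split=> [BN|[kN eN fN bN] b].
  by split; apply: BN; [exact: generated_by_ki|exact: generated_by_xip
    |exact: generated_by_xim|exact: generated_by_gen].
rewrite -!/(rho _ _ _); elim=> {b} [b||a c _ aN _ cN|a c _ aN _ cN|c a _ aN].
- case=> [->|->|->|[]->] //.
  have k1 t : t != 0 -> rho t s (ki q 1) *m rho t s (kiV q 1) = 1%:M.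
    by move=> t0; rewrite -rM// ki_kiV rho1.
  have k2 t : t != 0 -> rho t s (kiV q 1) *m rho t s (ki q 1) = 1%:M.
    by move=> t0; rewrite -rM// kiV_ki rho1.
  by rewrite -[LHS]mulmx1 -(k1 z z_neq0) !mulmxA -(mulmxA _ N) -kN !mulmxA k2// mul1mx.
- by rewrite !rho1// mulmx1 mul1mx.
- by rewrite !rhoD// mulmxDl mulmxDr aN cN.
- by rewrite !rM// -mulmxA cN mulmxA aN mulmxA.
- by rewrite !rhoZ// -scalemxAl aN scalemxAr.
Qed.

Lemma intertwines_Kmatrix : intertwines B s z (Kmatrix z).
Proof.
apply/intertwinesP; rewrite !(rho_Bminus q_neq0 dq_neq0 _ s_neq0 qD_neq0 dmE)//.
rewrite !(rho_genE q_neq0 dq_neq0 _ s_neq0)// /Kmatrix /TL lmx1 !lmxZ !lmxD.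
split; rewrite !lmxM /=; lmx_eq; rewrite /Kone /KTL; field;
  by rewrite ?q_neq0 ?z_neq0 ?s_neq0 ?oner_neq0.
Qed.

(** The equation for [ki 1] makes [N] block diagonal along weights, the one for [xip 1] leaves two
    free entries, and the one for [Bminus] relates these two. *)
Lemma intertwines_span (N : 'M[F]_(2 * 2)) : intertwines B s z N ->
  exists a b, N = a *: 1%:M + b *: TL /\ a * KTL z = b * Kone z.
Proof.
case/intertwinesP; rewrite !(rho_Bminus q_neq0 dq_neq0 _ s_neq0 qD_neq0 dmE)//.
rewrite !(rho_genE q_neq0 dq_neq0 _ s_neq0)//.
have [n ->] : exists n, N = mx4 (ltab (2 * 2) n).
  by exists (fun i j => (N : 'M_(3.+1)) (inord i) (inord j)); apply: lmx_entries.
rewrite !lmxM /= => kN eN _ bN.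
(* Since [ki 1] acts diagonally, entry (i, j) of its equation is [n i j] times a difference [c] of
   two of the eigenvalues q^2, 1, 1, q^-2. *)
have vanish m l l' i j c : c != 0 -> lmx m l = lmx m l' -> (i < m)%N -> (j < m)%N ->
    c * n i j = entry l i j - entry l' i j -> n i j = 0.
  move=> c0 ll' im jm; rewrite (lmx_inj ll' im jm) subrr => /eqP.
  by rewrite mulf_eq0 (negbTE c0) => /eqP.
have q1 : q ^+ 2 - 1 != 0 by [].
have q2 : 1 - q ^- 2 != 0.
  by rewrite -(mulfV (expf_neq0 2 q_neq0)) -[X in _ - X]mul1r -mulrBl mulf_neq0// invr_eq0 expf_neq0.
have q4 : q ^+ 2 - q ^- 2 != 0.
  have -> : q ^+ 2 - q ^- 2 = (q ^+ 2 - 1) * (q * q + 1) / q ^+ 2 by field.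
  by rewrite mulf_neq0 ?invr_eq0 ?expf_neq0// mulf_neq0.
have n01 : n 0%N 1%N = 0 by apply: (vanish _ _ _ _ _ _ q1 kN) => //; rewrite /entry /=; ring.
have n02 : n 0%N 2%N = 0 by apply: (vanish _ _ _ _ _ _ q1 kN) => //; rewrite /entry /=; ring.
have n03 : n 0%N 3%N = 0 by apply: (vanish _ _ _ _ _ _ q4 kN) => //; rewrite /entry /=; ring.
have n13 : n 1%N 3%N = 0 by apply: (vanish _ _ _ _ _ _ q2 kN) => //; rewrite /entry /=; ring.
have n23 : n 2%N 3%N = 0 by apply: (vanish _ _ _ _ _ _ q2 kN) => //; rewrite /entry /=; ring.
rewrite -oppr_eq0 in q1; rewrite -oppr_eq0 in q2; rewrite -oppr_eq0 in q4.
have n10 : n 1%N 0%N = 0 by apply: (vanish _ _ _ _ _ _ q1 kN) => //; rewrite /entry /=; ring.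
have n20 : n 2%N 0%N = 0 by apply: (vanish _ _ _ _ _ _ q1 kN) => //; rewrite /entry /=; ring.
have n30 : n 3%N 0%N = 0 by apply: (vanish _ _ _ _ _ _ q4 kN) => //; rewrite /entry /=; ring.
have n31 : n 3%N 1%N = 0 by apply: (vanish _ _ _ _ _ _ q2 kN) => //; rewrite /entry /=; ring.
have n32 : n 3%N 2%N = 0 by apply: (vanish _ _ _ _ _ _ q2 kN) => //; rewrite /entry /=; ring.
have := (lmx_inj eN (i := 0%N) (j := 1%N) isT isT, lmx_inj eN (i := 0%N) (j := 2%N) isT isT,
  lmx_inj eN (i := 1%N) (j := 3%N) isT isT, lmx_inj eN (i := 2%N) (j := 3%N) isT isT,
  lmx_inj bN (i := 0%N) (j := 1%N) isT isT).
rewrite /entry /= ?(n01, n02, n03, n13, n23, n10, n20, n30, n31, n32).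
rewrite !(mul0r, mulr0, addr0, add0r, mul1r, mulr1) => -[[[[e01 e02] e13] e23] b01].
have n22 : n 2%N 2%N = n 0%N 0%N - q * n 1%N 2%N by rewrite -e02; ring.
have n11 : n 1%N 1%N = n 3%N 3%N - n 1%N 2%N / q by rewrite e13; ring.
have n21 : n 2%N 1%N = q * n 0%N 0%N - q * n 1%N 1%N by rewrite [q * n 0%N _]mulrC -e01; ring.
(* The extreme weight spaces belong to one irreducible summand; the equations for [xip 1] give the
   equality after division by [q + q^-1]. *)
have n33 : n 3%N 3%N = n 0%N 0%N.
  apply/eqP; rewrite -subr_eq0 -(mulrI_eq0 _ (lregP qD_neq0)); apply/eqP.
  have -> : (q + q^-1) * (n 3%N 3%N - n 0%N 0%N) =
    q^-1 * n 3%N 3%N - (q * n 0%N 0%N - q * n 3%N 3%N + q^-1 * n 0%N 0%N) by ring.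
  by rewrite e23 n21 n22 n11; field.
rewrite n33 in n11; rewrite n11 in n21.
exists (n 0%N 0%N), (n 1%N 2%N); split.
  rewrite /TL lmx1 !lmxZ !lmxD; lmx_eq;
    rewrite ?(n01, n02, n03, n13, n23, n10, n20, n30, n31, n32, n22, n33, n21, n11);
    by field.
move: b01; rewrite n21 n11 => b01.
apply/eqP; rewrite -subr_eq0; apply/eqP.
set L := (X in X = _) in b01; set R := (X in _ = X) in b01.
transitivity (q * (R - L)); last by rewrite b01 subrr mulr0.
by rewrite /L /R /Kone /KTL; field; rewrite ?q_neq0 ?z_neq0 ?s_neq0 ?oner_neq0.
Qed.

(** Genericity keeps [Kone z] and [KTL z] from vanishing together, so the single equation
    [a * KTL z = b * Kone z] has a line of solutions. *)
Lemma is_Kmatrix_Kmatrix : generic q s z -> is_Kmatrix B s z (Kmatrix z).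
Proof.
move=> gen_z; have K_neq0 : (Kone z != 0) || (KTL z != 0).
  rewrite -negb_and; apply/negP => /andP[/eqP K0]; rewrite mulf_eq0 (negbTE dq_neq0).
  rewrite subr_eq0 => /eqP zE; have z2 : z ^+ 2 = 1 by rewrite expr2 {2}zE divff.
  apply: gen_z; split=> //.
  (* For z^-1 = z and z^2 = 1 this quadratic in [s] is [- s * Kone z]. *)
  have : (s - z * q ^+ 2) * (s - z * q ^- 2) = 0.
    transitivity (z ^+ 2 - 1 - s * (Kone z)); last by rewrite z2 K0 subrr mulr0 subr0.
    by rewrite /Kone -zE; field; rewrite q_neq0 s_neq0.
  by move/eqP; rewrite mulf_eq0 !subr_eq0 => /orP[] /eqP; [left|right].
split.
  apply: contraTneq K_neq0; rewrite negb_or !negbK.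
  rewrite /Kmatrix /TL lmx1 !lmxZ !lmxD => K0.
  have := (lmx_eq0 K0 (i := 0%N) (j := 0%N) isT isT, lmx_eq0 K0 (i := 1%N) (j := 2%N) isT isT).
  by rewrite /entry /= !(mulr0, mulr1, addr0, add0r) => -[-> ->]; rewrite eqxx.
move=> N; split=> [/intertwines_span[a [b [-> ab]]]|[c ->] x Bx]; last first.
  by have := intertwines_Kmatrix Bx; rewrite -scalemxAr -scalemxAl => ->.
(* The scalar is the ratio taken at a coefficient of [Kmatrix z] that does not vanish. *)
have [K0|K0] := eqVneq (Kone z) 0.
  rewrite K0 eqxx /= in K_neq0; exists (b / KTL z); rewrite /Kmatrix K0.
  move/eqP: ab; rewrite K0 mulr0 mulf_eq0 (negbTE K_neq0) orbF => /eqP ->.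
  by rewrite !scale0r !add0r scalerA mulfVK.
exists (a / Kone z); rewrite /Kmatrix scalerDr !scalerA mulfVK//.
by rewrite mulrAC ab mulfK.
Qed.

End KMatrix.

(** * The reflection equation *)

Section TemperleyLieb.
Variables (F : fieldType) (A : algType F) (d : F) (u v : A).
Hypotheses (uu : u * u = d *: u) (vv : v * v = d *: v).
Hypotheses (uvu : u * v * u = u) (vuv : v * u * v = v).

(* Reversing words exchanges the two sides, so only the coefficients of u * v and
   v * u can differ; the hypothesis is the equality of these two. *)
Lemma TL_reflection (r1 r2 x b x' b' : F) :
  x * b' * (r1 + r2 + d * r1 * r2) + r1 * b * x' + d * r1 * b * b' + r1 * r2 * b * b'
    = r2 * b * x' ->
  (1 + r1 *: u) * (x *: 1 + b *: v) * (1 + r2 *: u) * (x' *: 1 + b' *: v) =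
  (x' *: 1 + b' *: v) * (1 + r2 *: u) * (x *: 1 + b *: v) * (1 + r1 *: u).
Proof.
move=> E.
have uuv : u * u * v = d *: (u * v) by rewrite uu scalerAl.
have vuu : v * u * u = d *: (v * u) by rewrite -mulrA uu scalerAr.
have uvv : u * v * v = d *: (u * v) by rewrite -mulrA vv scalerAr.
have vvu : v * v * u = d *: (v * u) by rewrite vv scalerAl.
rewrite !(mulrDl, mulrDr) -!(scalerAl, scalerAr) !(mul1r, mulr1).
rewrite !(uuv, vuu, uvv, vvu, uvu, vuv, uu, vv) -?scalerAl ?(uvu, vuv, uu, vv).
(* The goals for [u * v] and [v * u] are [E] in opposite orientations, hence the two
   alternatives. *)
by lin F; first [ring|apply/eqP; rewrite -subr_eq0; apply/eqP;
  first [rewrite -[RHS](subrr (r2 * b * x')) -{1}E; ring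
        |rewrite -[RHS](subrr (r2 * b * x')) -{2}E; ring]].
Qed.

End TemperleyLieb.

(** * Operators on three tensor factors *)

Section Legs.
Variable F : fieldType.
Implicit Types X Y : 'M[F]_(2 * 2).

Lemma leg12M X Y : leg12 (X *m Y) = leg12 X *m leg12 Y.
Proof. by rewrite /leg12 tensmx_mul mulmx1. Qed.

Lemma leg23M X Y : leg23 (X *m Y) = leg23 X *m leg23 Y.
Proof.
have := tensmx_mul (1%:M : 'M[F]_2) X (1%:M : 'M[F]_2) Y.
by rewrite mulmx1 => /esym.
Qed.

Lemma leg12D X Y : leg12 (X + Y) = leg12 X + leg12 Y.
Proof. exact: tensmxDl. Qed.

Lemma leg23D X Y : leg23 (X + Y) = leg23 X + leg23 Y.
Proof. exact (@tensmxDr F 2 (2 * 2) 1%:M X Y). Qed.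

Lemma leg12Z c X : leg12 (c *: X) = c *: leg12 X.
Proof. exact: tensmxZl. Qed.

Lemma leg23Z c X : leg23 (c *: X) = c *: leg23 X.
Proof. exact (@tensmxZr F 2 (2 * 2) c 1%:M X). Qed.

Lemma leg12_1 : leg12 1%:M = 1%:M :> 'M[F]_(2 * 2 * 2).
Proof. exact: tensmx11. Qed.

Lemma leg23_1 : leg23 1%:M = 1%:M :> 'M[F]_(2 * 2 * 2).
Proof. exact: (@tensmx11 F 2 (2 * 2)). Qed.

Lemma flipE : flip F = lmx (2 * 2) [:: [:: 1; 0; 0; 0]; [:: 0; 0; 1; 0];
                                       [:: 0; 1; 0; 0]; [:: 0; 0; 0; 1]].
Proof.
rewrite /flip !big_ord_recl !big_ord0 !addr0 !delta2E !lmx_tens !lmxD /=.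
by lmx_eq; ring.
Qed.

Lemma flipK : flip F *m flip F = 1%:M.
Proof. by rewrite flipE lmxM lmx1 /=; lmx_eq; ring. Qed.

End Legs.

Section ReflectionEquation.
Variables (F : fieldType) (q : F).
Hypothesis q_neq0 : q != 0.
Local Notation U12 := (leg12 (TL q)).
Local Notation U23 := (leg23 (TL q)).
Local Notation P12 := (leg12 (flip F)).
Local Notation P23 := (leg23 (flip F)).

Lemma TL_sqr : TL q *m TL q = - (q + q^-1) *: TL q.
Proof. by rewrite /TL lmxM lmxZ /=; lmx_eq; field. Qed.

Lemma flip_Rmatrix z : flip F *m Rmatrix q z =
  1%:M + ((z - 1) / (q * z - q^-1)) *: TL q.
Proof.
rewrite flipE /TL lmx1 lmxZ lmxD -[Rmatrix q z]/(lmx (2 * 2) _) lmxM /=.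
by lmx_eq; ring.
Qed.

Let mx1_2 : (1%:M : 'M[F]_2) = lmx 2 [:: [:: 1; 0]; [:: 0; 1]].
Proof. by rewrite lmx1. Qed.

Let U12E : U12 = lmx (2 * 2 * 2)
    [:: [:: 0; 0; 0; 0; 0; 0; 0; 0];
      [:: 0; 0; 0; 0; 0; 0; 0; 0];
      [:: 0; 0; - q^-1; 0; 1; 0; 0; 0];
      [:: 0; 0; 0; - q^-1; 0; 1; 0; 0];
      [:: 0; 0; 1; 0; - q; 0; 0; 0];
      [:: 0; 0; 0; 1; 0; - q; 0; 0];
      [:: 0; 0; 0; 0; 0; 0; 0; 0];
      [:: 0; 0; 0; 0; 0; 0; 0; 0]].
Proof.
rewrite /leg12 /TL mx1_2 lmx_tens; lmx_eq; rewrite ?(mul0r, mulr0, mul1r, mulr1)//.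
Qed.

Let U23E : U23 = lmx (2 * 2 * 2)
    [:: [:: 0; 0; 0; 0; 0; 0; 0; 0];
      [:: 0; - q^-1; 1; 0; 0; 0; 0; 0];
      [:: 0; 1; - q; 0; 0; 0; 0; 0];
      [:: 0; 0; 0; 0; 0; 0; 0; 0];
      [:: 0; 0; 0; 0; 0; 0; 0; 0];
      [:: 0; 0; 0; 0; 0; - q^-1; 1; 0];
      [:: 0; 0; 0; 0; 0; 1; - q; 0];
      [:: 0; 0; 0; 0; 0; 0; 0; 0]].
Proof.
rewrite /leg23 /TL mx1_2 lmx_tens; lmx_eq; rewrite ?(mul0r, mulr0, mul1r, mulr1)//.
Qed.

Let P12E : P12 = lmx (2 * 2 * 2)
    [:: [:: 1; 0; 0; 0; 0; 0; 0; 0];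
      [:: 0; 1; 0; 0; 0; 0; 0; 0];
      [:: 0; 0; 0; 0; 1; 0; 0; 0];
      [:: 0; 0; 0; 0; 0; 1; 0; 0];
      [:: 0; 0; 1; 0; 0; 0; 0; 0];
      [:: 0; 0; 0; 1; 0; 0; 0; 0];
      [:: 0; 0; 0; 0; 0; 0; 1; 0];
      [:: 0; 0; 0; 0; 0; 0; 0; 1]].
Proof.
rewrite /leg12 flipE mx1_2 lmx_tens; lmx_eq; rewrite ?(mul0r, mulr0, mul1r, mulr1)//.
Qed.

Let P23E : P23 = lmx (2 * 2 * 2)
    [:: [:: 1; 0; 0; 0; 0; 0; 0; 0];
      [:: 0; 0; 1; 0; 0; 0; 0; 0];
      [:: 0; 1; 0; 0; 0; 0; 0; 0];
      [:: 0; 0; 0; 1; 0; 0; 0; 0];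
      [:: 0; 0; 0; 0; 1; 0; 0; 0];
      [:: 0; 0; 0; 0; 0; 0; 1; 0];
      [:: 0; 0; 0; 0; 0; 1; 0; 0];
      [:: 0; 0; 0; 0; 0; 0; 0; 1]].
Proof.
rewrite /leg23 flipE mx1_2 lmx_tens; lmx_eq; ring.
Qed.


Ltac simpl01 := rewrite ?(mul0r, mulr0, mul1r, mulr1, add0r, addr0) //.

Let U12U23 : U12 *m U23 = lmx (2 * 2 * 2)
    [:: [:: 0; 0; 0; 0; 0; 0; 0; 0];
      [:: 0; 0; 0; 0; 0; 0; 0; 0];
      [:: 0; - q^-1; 1; 0; 0; 0; 0; 0];
      [:: 0; 0; 0; 0; 0; - q^-1; 1; 0];
      [:: 0; 1; - q; 0; 0; 0; 0; 0];
      [:: 0; 0; 0; 0; 0; 1; - q; 0];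
      [:: 0; 0; 0; 0; 0; 0; 0; 0];
      [:: 0; 0; 0; 0; 0; 0; 0; 0]].
Proof. by rewrite U12E U23E lmxM; lmx_eq; simpl01; field. Qed.

Let U121 : U12 *m U23 *m U12 = U12.
Proof. by rewrite U12U23 U12E lmxM; lmx_eq; simpl01; field. Qed.

Let U23U12 : U23 *m U12 = lmx (2 * 2 * 2)
    [:: [:: 0; 0; 0; 0; 0; 0; 0; 0];
      [:: 0; 0; - q^-1; 0; 1; 0; 0; 0];
      [:: 0; 0; 1; 0; - q; 0; 0; 0];
      [:: 0; 0; 0; 0; 0; 0; 0; 0];
      [:: 0; 0; 0; 0; 0; 0; 0; 0];
      [:: 0; 0; 0; - q^-1; 0; 1; 0; 0];
      [:: 0; 0; 0; 1; 0; - q; 0; 0];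
      [:: 0; 0; 0; 0; 0; 0; 0; 0]].
Proof. by rewrite U23E U12E lmxM; lmx_eq; simpl01; field. Qed.

Let U232 : U23 *m U12 *m U23 = U23.
Proof. by rewrite U23U12 U23E lmxM; lmx_eq; simpl01; field. Qed.

Let P23U12 : P23 *m U12 = lmx (2 * 2 * 2)
    [:: [:: 0; 0; 0; 0; 0; 0; 0; 0];
      [:: 0; 0; - q^-1; 0; 1; 0; 0; 0];
      [:: 0; 0; 0; 0; 0; 0; 0; 0];
      [:: 0; 0; 0; - q^-1; 0; 1; 0; 0];
      [:: 0; 0; 1; 0; - q; 0; 0; 0];
      [:: 0; 0; 0; 0; 0; 0; 0; 0];
      [:: 0; 0; 0; 1; 0; - q; 0; 0];
      [:: 0; 0; 0; 0; 0; 0; 0; 0]].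
Proof. by rewrite P23E U12E lmxM; lmx_eq; simpl01. Qed.

Let P12U23 : P12 *m U23 = lmx (2 * 2 * 2)
    [:: [:: 0; 0; 0; 0; 0; 0; 0; 0];
      [:: 0; - q^-1; 1; 0; 0; 0; 0; 0];
      [:: 0; 0; 0; 0; 0; 0; 0; 0];
      [:: 0; 0; 0; 0; 0; - q^-1; 1; 0];
      [:: 0; 1; - q; 0; 0; 0; 0; 0];
      [:: 0; 0; 0; 0; 0; 0; 0; 0];
      [:: 0; 0; 0; 0; 0; 1; - q; 0];
      [:: 0; 0; 0; 0; 0; 0; 0; 0]].
Proof. by rewrite P12E U23E lmxM; lmx_eq; simpl01. Qed.

Let leg13_TL : leg13 (TL q) = P12 *m U23 *m P12.
Proof. by rewrite /leg13 P23U12 P12U23 P12E P23E !lmxM; lmx_eq; simpl01. Qed.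

Variable s : F.
Local Notation K z := (Kmatrix q s z).

Let P12K : P12 *m P12 = 1%:M.
Proof. by rewrite -leg12M flipK leg12_1. Qed.

Let P23K : P23 *m P23 = 1%:M.
Proof. by rewrite -leg23M flipK leg23_1. Qed.

(* Both sides are K acting on the outer factors; this form brings leg13 next to the
   flips hidden in R, and flip * R = 1 + r * TL removes all of them. *)
Let leg13_K z : leg13 (K z) = P12 *m leg23 (K z) *m P12.
Proof.
rewrite /leg13 /Kmatrix leg12D leg23D !leg12Z !leg23Z leg12_1 leg23_1.
rewrite !mulmxDr !mulmxDl -!(scalemxAl, scalemxAr) -/(leg13 (TL q)) leg13_TL.
by rewrite !mulmx1 P12K P23K.
Qed.

Let leg12_R z : P12 *m leg12 (Rmatrix q z) =
  1%:M + ((z - 1) / (q * z - q^-1)) *: U12.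
Proof. by rewrite -leg12M flip_Rmatrix leg12D leg12Z leg12_1. Qed.

Let leg21_R z : leg21 (Rmatrix q z) *m P12 =
  1%:M + ((z - 1) / (q * z - q^-1)) *: U12.
Proof.
by rewrite /leg21 !leg12M -(mulmxA _ P12) P12K mulmx1 leg12_R.
Qed.

(** The two flips around [leg23 (K z)] are absorbed by the neighbouring R-matrices, each of which
    becomes [1 + r *: U12]. What remains is [TL_reflection] with [u = U12] and [v = U23]. *)
Lemma reflection_equation_Kmatrix z w : z != 0 -> w != 0 ->
  s != 0 -> q * (z / w) - q^-1 != 0 -> q * (z * w) - q^-1 != 0 ->
  leg21 (Rmatrix q (z / w)) *m leg13 (K z) *m leg12 (Rmatrix q (z * w)) *m leg23 (K w)
  = leg23 (K w) *m leg21 (Rmatrix q (z * w)) *m leg13 (K z) *m leg12 (Rmatrix q (z / w)).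
Proof.
move=> z0 w0 s0 zw_neq0 zw_neq0'; rewrite !leg13_K !mulmxA.
rewrite -[leg23 (K w) *m leg21 _ *m P12]mulmxA !leg21_R.
rewrite -!(mulmxA _ P12) !leg12_R /Kmatrix !leg23D !leg23Z leg23_1.
(* The denominators of the R-matrices are cleared of inverses to match the side conditions of
   [field]. *)
have zwE : q * (z / w) - q^-1 = (q * q * z - w) / (q * w) by field; rewrite q_neq0 w0.
have zwE' : q * (z * w) - q^-1 = (q * q * z * w - 1) / q by field.
have zw : q * q * z - w != 0.
  by apply: contraNneq zw_neq0 => zw; rewrite zwE zw mul0r.
have zw' : q * q * z * w - 1 != 0.
  by apply: contraNneq zw_neq0' => zw'; rewrite zwE' zw' mul0r.
apply: (@TL_reflection F 'M[F]_8 (- (q + q^-1)) U12 U23).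
- rewrite -[LHS]/(U12 *m U12) -leg12M TL_sqr; exact: leg12Z.
- rewrite -[LHS]/(U23 *m U23) -leg23M TL_sqr; exact: leg23Z.
- exact: U121.
- exact: U232.
rewrite /Kone /KTL; field; rewrite s0 w0 q_neq0 z0 /=; apply/andP; split.
  by have -> : q * (z * w) * q - 1 = q * q * z * w - 1 by ring.
by have -> : q * z * q + -1 * w = q * q * z - w by ring.
Qed.

(** K-matrices are fixed only up to a scalar at each spectral parameter; both sides carry the factor
    [c * c']. *)
Lemma reflection_equation c c' z w : z != 0 -> w != 0 ->
  s != 0 -> q * (z / w) - q^-1 != 0 -> q * (z * w) - q^-1 != 0 ->
  leg21 (Rmatrix q (z / w)) *m leg13 (c *: K z) *m
    leg12 (Rmatrix q (z * w)) *m leg23 (c' *: K w)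
  = leg23 (c' *: K w) *m leg21 (Rmatrix q (z * w)) *m
    leg13 (c *: K z) *m leg12 (Rmatrix q (z / w)).
Proof.
move=> z0 w0 s0 zw zw'; have RE := reflection_equation_Kmatrix z0 w0 s0 zw zw'.
rewrite /leg13 leg12Z !leg23Z -!(scalemxAl, scalemxAr) -!/(leg13 _).
by rewrite RE !scalerA mulrC.
Qed.

End ReflectionEquation.

(** Otherwise [q] would be a root of X, X^2 - 1 or X^2 + 1. *)
Lemma transcendental_neq0 (R : realType) (q : R[i]) : transcendental q ->
  [/\ q != 0, q - q^-1 != 0 & q + q^-1 != 0].
Proof.
move=> q_tr.
have q0 : q != 0.
  apply/negP => /eqP q0; apply: q_tr; exists 'X; first by rewrite -size_poly_eq0 size_polyX.
  by rewrite map_polyX rootX q0.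
have sq c : (c = 1) \/ (c = -1) -> q + (ratr c : R[i]) * q^-1 != 0.
  move=> c1; apply/negP => /eqP E; apply: q_tr; exists ('X^2 + c%:P).
    by rewrite -size_poly_eq0 size_polyDl ?size_polyXn// (leq_ltn_trans (size_polyC_leq1 _)).
  rewrite rmorphD /= map_polyXn map_polyC /= rootE !hornerE.
  have -> : q ^+ 2 + ratr c = (q + ratr c * q^-1) * q by field.
  by rewrite E mul0r.
split=> //.
  by have := sq (-1) (or_intror erefl); rewrite rmorphN1 mulN1r.
by have := sq 1 (or_introl erefl); rewrite rmorph1 mul1r.
Qed.

Theorem proposition2p4 (R : realType) (q : R[i]) (q_tr : transcendental q)
    (dm dp : R[i]) (dm_neq0 : dm != 0)
    (dp_def : dp = dm^-1 * (q + q^-1) ^- 2) :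
  let B := generated_by (Bminus q dm) in
  [/\ left_coideal B,
      (forall b, B b <-> generated_by (Bplus q dp) b)
    & q ^+ 2 * dp = (q + q^-1)^-1 -> q ^- 2 * dm = (q + q^-1)^-1 ->
      forall s : R[i], s != 0 ->
      (forall z, z != 0 -> generic q s z -> exists M, is_Kmatrix B s z M) /\
      (forall K : R[i] -> 'M[R[i]]_(2 * 2),
        (forall z, z != 0 -> generic q s z -> is_Kmatrix B s z (K z)) ->
        forall z w, z != 0 -> w != 0 -> generic q s z -> generic q s w ->
        q * (z / w) - q^-1 != 0 -> q * (z * w) - q^-1 != 0 ->
        leg21 (Rmatrix q (z / w)) *m leg13 (K z) *m
          leg12 (Rmatrix q (z * w)) *m leg23 (K w)
        = leg23 (K w) *m leg21 (Rmatrix q (z * w)) *m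
          leg13 (K z) *m leg12 (Rmatrix q (z / w)))].
Proof.
move=> B; have [q0 dq0 qD0] := transcendental_neq0 q_tr.
split.
- exact: left_coideal_Bminus.
- by move=> b; apply: generated_by_Bminus_Bplus.
move=> _ dmE s s0; split=> [z z0 gz|K KP z w z0 w0 gz gw zw zw'].
  by exists (Kmatrix q s z); apply: is_Kmatrix_Kmatrix.
(* [K t] is a solution because it is the multiple of itself by 1, and all solutions lie on the line
   through [Kmatrix q s t]. *)
have Kscal t : t != 0 -> generic q s t -> exists c, K t = c *: Kmatrix q s t.
  move=> t0 gt; have [_ KM] := is_Kmatrix_Kmatrix q0 dq0 qD0 s0 dmE t0 gt.
  apply/KM; have [_ KK] := KP t t0 gt; apply/KK.
  by exists 1; rewrite scale1r.
have [c ->] := Kscal z z0 gz; have [c' ->] := Kscal w w0 gw.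
exact: (reflection_equation q0 c c' z0 w0 s0 zw zw').
Qed.
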